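(* Let $L\in\mathbb{N}^*$ and let $\mu=(\mu_\Delta)_{\Delta\in\mathbb{N}}\in\mathcal{P}(\mathbb{N}^* )^{\mathbb{N}}$. For the GLPP with parameter $\mu$ on the cylinder of size $L$, the process $(\tilde F_n)_{n\in\mathbb{N}}$ is a Markov chain on $\tilde{\mathcal{B}}_L$, and so $(F_n)_{n\in\mathbb{N}}$ is a hidden Markov chain. Moreover, if there exists $\alpha>0$ such that $$\inf_{\Delta\in\mathbb{N},\,t\in\mathbb{N}^*}\frac{\mu_\Delta(t)}{\sum_{s\ge t}\mu_\Delta(s)}\ge\alpha,$$ then they are ergodic.
   Context: $\mathbb{N}=\{0,1,\dots\}$, $\mathbb{N}^*=\{1,2,\dots\}$. $\mathcal{P}(\mathbb{N}^* )$ is the set of probability measures $\mu$ on $\mathbb{N}^*$ with full support ($\mu(i)>0$ for all $i\in\mathbb{N}^*$). GLPP on the cylinder. For $L\in\mathbb{N}^*$ let $\mathcal{C}_L=\{(x,y): x\in\mathbb{Z}/2L\mathbb{Z},\ y\in\mathbb{N},\ x+y=0 \bmod 2\}$ (its elements are called cells). The Generalised directed Last Passage Percolation (GLPP) with parameter $\mu=(\mu_\Delta)_{\Delta\in\mathbb{N}}$ on the cylinder of size $L$ is the random family $(\tau(z))_{z\in\mathcal{C}_L}$ defined by $\tau((x,0))=0$ for all cells $(x,0)$ and, for $y\ge1$, $$\tau((x,y))=\max(\tau((x-1,y-1)),\tau((x+1,y-1)))+\xi_{(x,y)},$$ where, conditionally on the values of $\tau$ on rows $0,\dots,y-1$, the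 variables $\xi_{(x,y)}$ of row $y$ are independent and $\xi_{(x,y)}\sim\mu_{|\tau((x-1,y-1))-\tau((x+1,y-1))|}$. Front line. For $i\in\mathbb{Z}/2L\mathbb{Z}$ and $y\in\mathbb{N}$ let $c_i(y)$ be the unique cell of row $y$ whose first coordinate is $i-1$ or $i$; $y\mapsto\tau(c_i(y))$ is strictly increasing. At time $n$, let $z_i=c_i(h)$ with $h=\max\{y:\tau(c_i(y))\le n\}$. Put $b_{n,i}=-1$ if $z_i$ has first coordinate $i$, $b_{n,i}=+1$ if $z_i$ has first coordinate $i-1$, and $t_{n,i}=n-\tau(z_i)$. The front line is $F_n=(b_{n,i})_{i\in\mathbb{Z}/2L\mathbb{Z}}$ (the curve separating $\{\tau\le n\}$ from $\{\tau>n\}$), and $\tilde F_n=(F_n,(t_{n,i})_{i\in\mathbb{Z}/2L\mathbb{Z}})$. State spaces. $\mathcal{B}_L=\{(b_i)\in\{-1,+1\}^{\mathbb{Z}/2L\mathbb{Z}}:\sum_i b_i=0\}$. For $b\in\mathcal{B}_L$, $\mathcal{T}_b$ is the set of $(t_i)\in\mathbb{N}^{\mathbb{Z}/2L\mathbb{Z}}$ such that for every $i$: if $b_i=b_{i+1}=1$ then $t_i<t_{i+1}$; if $b_i=b_{i+1}=-1$ then $t_i>t_{i+1}$; if $b_i=-1,b_{i+1}=1$ then $t_i=t_{i+1}$. $\tilde{\mathcal{B}}_L=\{(b,t):b\in\mathcal{B}_L,\ t\in\mathcal{T}_b\}$. A hidden Markov chain is a process of the form $\pi(\tilde H_n)$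 with $(\tilde H_n)$ a Markov chain and $\pi$ a function (here the projection $(b,t)\mapsto b$). A Markov chain on a countable space is ergodic if it is irreducible, aperiodic and positive recurrent; the hidden chain is called ergodic when it is the projection of an ergodic Markov chain. *)

(* Defs.v *)
From HB Require Import structures.
From mathcomp Require Import all_boot all_order all_algebra.
From mathcomp Require Import all_classical all_reals all_analysis.

Set Implicit Arguments.
Unset Strict Implicit.
Unset Printing Implicit Defensive.

Import Order.TTheory GRing.Theory Num.Theory.
Local Open Scope classical_set_scope.
Local Open Scope ring_scope.

(** * Markov chains on a countable state space

    A state space is a set [S] of elements of a countable type [E]; a kernel
    [Q] is only relevant on [S]. *)

Section MarkovChains.
Context {R : realType} {E : countType}.
Implicit Types (S : set E) (Q : E -> E -> R).
Local Open Scope ereal_scope.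

Definition stochastic S Q : Prop :=
  (forall s s', S s -> S s' -> (0 <= Q s s')%R) /\
  (forall s, S s -> \esum_(s' in S) (Q s s')%:E = 1).

Fixpoint kernel_pow S Q (n : nat) (s s' : E) : \bar R :=
  if n is n'.+1 then \esum_(u in S) ((Q s u)%:E * kernel_pow S Q n' u s')
  else ((s == s')%:R)%:E.

Definition irreducible S Q : Prop :=
  forall s s', S s -> S s' -> exists n, 0 < kernel_pow S Q n s s'.

(* The gcd of the possible return times to [s] is 1. *)
Definition aperiodic S Q : Prop :=
  forall s, S s -> forall d : nat,
    (forall n, (0 < n)%N -> 0 < kernel_pow S Q n s s -> (d %| n)%N) -> d = 1%N.

(* [first_passage S Q n s s'] is the probability, starting from [s], that the
   first visit to [s'] at a positive time occurs at time [n.+1]. *)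
Fixpoint first_passage S Q (n : nat) (s s' : E) : \bar R :=
  if n is n'.+1 then
    \esum_(u in S `\ s') ((Q s u)%:E * first_passage S Q n' u s')
  else (Q s s')%:E.

(* The return time to each state is almost surely finite, with finite mean. *)
Definition positive_recurrent S Q : Prop :=
  forall s, S s ->
    \sum_(0 <= n <oo) first_passage S Q n s s = 1 /\
    \sum_(0 <= n <oo) (n.+1%:R%:E * first_passage S Q n s s) < +oo.

Definition ergodic_kernel S Q : Prop :=
  [/\ irreducible S Q, aperiodic S Q & positive_recurrent S Q].

Context {d : measure_display} {Omega : measurableType d}.
Variable P : probability Omega R.

(* The identity on trajectories is the Markov property with one-step
   transition probabilities [Q], conditional probabilities being multiplied
   out. *)
Definition markov_with S Q (X : nat -> Omega -> E) : Prop :=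
  [/\ stochastic S Q,
      (forall n s, measurable (X n @^-1` [set s])),
      (forall n, P (X n @^-1` S) = 1)
    & (forall n (s : nat -> E), (forall k, S (s k)) ->
        P [set w | forall k, (k <= n.+1)%N -> X k w = s k] =
        P [set w | forall k, (k <= n)%N -> X k w = s k]
        * (Q (s n) (s n.+1))%:E)].

Definition markov_chain S (X : nat -> Omega -> E) : Prop :=
  exists Q, markov_with S Q X.

Definition ergodic_markov_chain S (X : nat -> Omega -> E) : Prop :=
  exists Q, markov_with S Q X /\ ergodic_kernel S Q.

Definition hidden_markov_chain {E' : Type} S (pi : E -> E')
    (Y : nat -> Omega -> E') : Prop :=
  exists X, markov_chain S X /\ forall n, Y n = pi \o X n.

Definition ergodic_hidden_markov_chain {E' : Type} S (pi : E -> E')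
    (Y : nat -> Omega -> E') : Prop :=
  exists X, ergodic_markov_chain S X /\ forall n, Y n = pi \o X n.

End MarkovChains.

(** * The GLPP on the cylinder

    The indices in Z/2LZ have type ['Z_(2 * L)], which has the intended meaning
    for [0 < L].  Families indexed by cells are families indexed by all of
    ['Z_(2 * L) * nat] of which only the values at cells matter. *)

(* Probability measures on the positive integers with full support, as
   measures on [nat]. *)
Definition full_support {R : realType} (m : probability nat R) : Prop :=
  m [set 0%N] = 0%E /\ forall i, (0 < i)%N -> (0 < m [set i])%E.

Section GLPP.
Context {L : nat}.

Definition is_cell (x : 'Z_(2 * L)) (y : nat) : bool := ~~ odd (x + y)%N.

(* The conditional law of row [y.+1] given rows [0..y] is written for every
   trajectory [a] of rows [0..y] and every value [k] of the variables of
   row [y.+1]. *)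
Definition is_glpp {R : realType} {d : measure_display}
    {Omega : measurableType d} (P : probability Omega R)
    (mu : nat -> probability nat R)
    (xi : 'Z_(2 * L) -> nat -> {RV P >-> nat})
    (tau : 'Z_(2 * L) -> nat -> Omega -> nat) : Prop :=
  [/\ (forall x w, is_cell x 0 -> tau x 0%N w = 0%N),
      (forall x y w, is_cell x y.+1 ->
         tau x y.+1 w
         = (maxn (tau (x - 1)%R y w) (tau (x + 1)%R y w) + xi x y.+1 w)%N)
    & (forall (y : nat) (a : 'Z_(2 * L) -> nat -> nat) (k : 'Z_(2 * L) -> nat),
         let past := [set w | forall x y', (y' <= y)%N -> is_cell x y' ->
                                tau x y' w = a x y'] in
         P (past `&` [set w | forall x, is_cell x y.+1 -> xi x y.+1 w = k x])
         = (P past *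
            \prod_(x : 'Z_(2 * L) | is_cell x y.+1)
              mu `|a (x - 1)%R y - a (x + 1)%R y|%N [set k x])%E)].

Section FrontLine.
Context {Omega : Type}.
Variable tau : 'Z_(2 * L) -> nat -> Omega -> nat.

(* First coordinate of the cell c_i(y). *)
Definition zigzag (i : 'Z_(2 * L)) (y : nat) : 'Z_(2 * L) :=
  if is_cell i y then i else i - 1.

(* The maximum of [{y | tau (c_i(y)) <= n}], with default value 0 if it does
   not exist; it exists as soon as the xi are all positive, hence almost
   surely. *)
Definition front_height (n : nat) (w : Omega) (i : 'Z_(2 * L)) : nat :=
  xget 0%N [set h | (tau (zigzag i h) h w <= n)%N /\
                    forall y, (tau (zigzag i y) y w <= n)%N -> (y <= h)%N].

Definition front_cell (n : nat) (w : Omega) (i : 'Z_(2 * L)) :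
    'Z_(2 * L) * nat :=
  let h := front_height n w i in (zigzag i h, h).

Definition front (n : nat) (w : Omega) : {ffun 'Z_(2 * L) -> int} :=
  [ffun i => if (front_cell n w i).1 == i then -1 else 1].

Definition front_age (n : nat) (w : Omega) : {ffun 'Z_(2 * L) -> nat} :=
  [ffun i => let z := front_cell n w i in (n - tau z.1 z.2 w)%N].

Definition timed_front (n : nat) (w : Omega) :
    {ffun 'Z_(2 * L) -> int} * {ffun 'Z_(2 * L) -> nat} :=
  (front n w, front_age n w).

End FrontLine.
End GLPP.

Section StateSpaces.
Variable L : nat.

Definition bridges : set {ffun 'Z_(2 * L) -> int} :=
  [set b : {ffun 'Z_(2 * L) -> int} |
    (forall i, b i = -1 \/ b i = 1) /\ \sum_i b i = 0].

Definition ages (b : {ffun 'Z_(2 * L) -> int}) :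
    set {ffun 'Z_(2 * L) -> nat} :=
  [set t : {ffun 'Z_(2 * L) -> nat} | forall i,
     [/\ (b i = 1 -> b (i + 1) = 1 -> (t i < t (i + 1)%R)%N),
         (b i = -1 -> b (i + 1) = -1 -> (t (i + 1)%R < t i)%N)
       & (b i = -1 -> b (i + 1) = 1 -> t i = t (i + 1))]].

Definition timed_bridges :
    set ({ffun 'Z_(2 * L) -> int} * {ffun 'Z_(2 * L) -> nat}) :=
  [set bt | bridges bt.1 /\ ages bt.1 bt.2].

End StateSpaces.
Arguments bridges : clear implicits.
Arguments timed_bridges : clear implicits.

Definition hazard_rates {R : realType} (mu : nat -> probability nat R) :
    set R :=
  [set r | exists Delta t : nat, (0 < t)%N /\
     r = fine (mu Delta [set t])
         / fine (\sum_(t <= s <oo) mu Delta [set s])%E].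

(* Main.v *)
Require Import Defs.
From HB Require Import structures.
From mathcomp Require Import all_boot all_order all_algebra.
From mathcomp Require Import all_classical all_reals all_analysis.
From mathcomp Require Import zify ring.
Import Order.TTheory GRing.Theory Num.Theory.
Local Open Scope classical_set_scope.
Local Open Scope ring_scope.

(** At time n, the cells that wait to be filled sit above the peaks of the front
    line (the columns i with b i = 1 and b (i + 1) = -1). The ages at a peak give
    both the parameter of the waiting time of the cell, [|t i - t (i + 1)|], and
    the time m = min (t i) (t (i + 1)) already waited. Hence, given the past, the
    peaks flip independently at time n + 1, the peak i with the probability
    mu Delta (m + 1) / mu Delta (> m) for its own Delta and m. This is the
    transition kernel [flip_kernel].

    The law of the passage times is however given row by row and not time by time.
    The two orders are reconciled as follows. The history of the front line up to
    time n determines, and is determined by, the passage times at most n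
    ([snapshot_agree], [agree_snapshot]). So a history is an event that constrains
    each variable xi separately: its value is known, or a lower bound is known, or
    nothing is known ([visible]); and a variable is constrained only if the
    constraints on earlier rows determine its parameter. Such events have a product
    probability ([cylinder_law]). From time n to time n + 1, only the factors of the
    cells above the peaks change, and each is multiplied by its conditional
    probability ([visible_next]), which is the Markov property
    ([timed_front_markov]).

    Statements about paths of the chain are reduced to deterministic passage times,
    because any growing family of passage times gives a path of positive
    probability from the flat state. In particular every state is reached from the
    flat state in every large enough number of steps ([timed_bridge_snapshot]).
    If the hazard rates are at least alpha, then all peaks flip at once with
    probability at least alpha to the power 2 L. This synchronous dynamics forgets
    the initial state: after L or L + 1 steps the state is the flat one
    ([eager_flat]). Hence every state is reached, from all states simultaneously,
    with a probability bounded below, in every large enough number of steps. This is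
    Doeblin's condition, which implies ergodicity ([doeblin_ergodic]). *)

Set Implicit Arguments.
Unset Strict Implicit.
Unset Printing Implicit Defensive.

(** * Columns and levels of the cylinder *)

Section Cylinder.
Variables (L : nat) (hL : (0 < L)%N).
Implicit Types (x i j : 'Z_(2 * L)) (y : nat).

Lemma card_cylinder : (Zp_trunc (2 * L)).+2 = (2 * L)%N.
Proof. by rewrite Zp_cast //; lia. Qed.

Lemma odd_addr x x' : odd (x + x')%R = odd x (+) odd x'.
Proof.
have ev : odd (Zp_trunc (2 * L)).+2 = false by rewrite card_cylinder oddM.
by rewrite /= [LHS](odd_mod _ ev) oddD.
Qed.

Lemma odd_oppr x : odd (- x)%R = odd x.
Proof.
by have := odd_addr (- x) x; rewrite addNr /=; case: (odd _); case: (odd _).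
Qed.

Lemma odd_natr k : odd (k%:R : 'Z_(2 * L)) = odd k.
Proof.
have ev : odd (Zp_trunc (2 * L)).+2 = false by rewrite card_cylinder oddM.
have odd1 : odd (1%R : 'Z_(2 * L)) by rewrite [odd _](odd_mod 1 ev).
by elim: k => // k IH; rewrite -natr1 odd_addr IH odd1 addbT.
Qed.

Lemma is_cellS x y : is_cell x y.+1 = ~~ is_cell x y.
Proof. by rewrite /is_cell addnS. Qed.

Lemma is_cell_add1 x y : is_cell (x + 1) y = ~~ is_cell x y.
Proof.
rewrite /is_cell !oddD odd_addr (odd_natr 1).
by case: (odd x); case: (odd y).
Qed.

Lemma is_cell_sub1 x y : is_cell (x - 1) y = ~~ is_cell x y.
Proof.
rewrite /is_cell !oddD odd_addr odd_oppr (odd_natr 1).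
by case: (odd x); case: (odd y).
Qed.

Lemma subr1_neq x : (x - 1 == x) = false.
Proof.
apply/eqP => h; have := is_cell_sub1 x 0; rewrite h.
by case: is_cell.
Qed.

Lemma zigzag_cell i y : is_cell (zigzag i y) y.
Proof. by rewrite /zigzag; case: ifP => // h; rewrite is_cell_sub1 h. Qed.

Lemma zigzag_same x y : is_cell x y -> zigzag x y = x.
Proof. by rewrite /zigzag => ->. Qed.

Lemma zigzag_next x y : is_cell x y -> zigzag (x + 1) y = x.
Proof. by rewrite /zigzag is_cell_add1 => ->; rewrite addrK. Qed.

Lemma zigzag_pred x y : ~~ is_cell x y -> zigzag x y = x - 1.
Proof. by rewrite /zigzag => /negbTE ->. Qed.

(** The passage times of an outcome whose waiting times are all positive, which
    happens almost surely. The evolution of the front line relies on nothing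
    else, and conversely the theory applies to passage times built by hand. *)
Definition growing (T : 'Z_(2 * L) -> nat -> nat) : Prop :=
  (forall x, is_cell x 0 -> T x 0%N = 0%N) /\
  (forall x y, is_cell x y.+1 ->
     (T (x - 1)%R y < T x y.+1)%N /\ (T (x + 1)%R y < T x y.+1)%N).

(** Up to conversion, [timed_front tau n w] is the snapshot of the passage times
    of the outcome [w]. *)
Definition snapshot (T : 'Z_(2 * L) -> nat -> nat) (n : nat) :
    {ffun 'Z_(2 * L) -> int} * {ffun 'Z_(2 * L) -> nat} :=
  timed_front (fun x y (_ : unit) => T x y) n tt.

Definition level (T : 'Z_(2 * L) -> nat -> nat) (n : nat) i : nat :=
  front_height (fun x y (_ : unit) => T x y) n tt i.

Implicit Types T : 'Z_(2 * L) -> nat -> nat.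

Lemma zigzag_growing T i y : growing T ->
  (T (zigzag i y) y < T (zigzag i y.+1) y.+1)%N.
Proof.
move=> [_ gT]; have [c|c] := boolP (is_cell i y).
  rewrite zigzag_same // zigzag_pred ?is_cellS ?negbK //.
  have := gT (i - 1) y; rewrite is_cell_sub1 is_cellS negbK c => /(_ isT) [_].
  by rewrite subrK.
rewrite zigzag_pred // zigzag_same ?is_cellS //.
by have := gT i y; rewrite is_cellS c => /(_ isT) [].
Qed.

Lemma row0_growing T x : growing T -> is_cell x 0 -> T x 0%N = 0%N.
Proof. by case=> h _; exact: h. Qed.

Lemma zigzag_ge T i y : growing T -> (y <= T (zigzag i y) y)%N.
Proof.
move=> gT; elim: y => [//|y IH].
by apply: leq_ltn_trans IH _; exact: zigzag_growing.
Qed.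

Lemma cell_ge T x y : growing T -> is_cell x y -> (y <= T x y)%N.
Proof. by move=> gT c; have := zigzag_ge x y gT; rewrite zigzag_same. Qed.

Lemma zigzag_leq T i y z : growing T -> (y <= z)%N ->
  (T (zigzag i y) y <= T (zigzag i z) z)%N.
Proof.
move=> gT; elim: z => [|z IH]; first by rewrite leqn0 => /eqP ->.
rewrite leq_eqVlt => /orP[/eqP -> //|]; rewrite ltnS => /IH h.
by apply: leq_trans h (ltnW _); exact: zigzag_growing.
Qed.

Lemma levelP T n i : growing T ->
  forall y, (T (zigzag i y) y <= n)%N = (y <= level T n i)%N.
Proof.
move=> gT.
pose B := [set h | (T (zigzag i h) h <= n)%N /\
                    forall y, (T (zigzag i y) y <= n)%N -> (y <= h)%N].
have [h [h1 h2]] : exists h, B h.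
  have e0 : exists y, (T (zigzag i y) y <= n)%N.
    by exists 0%N; rewrite (row0_growing gT (zigzag_cell _ _)).
  have b0 y : (T (zigzag i y) y <= n)%N -> (y <= n)%N.
    by apply: leq_trans; exact: zigzag_ge.
  case: (ex_maxnP e0 b0) => h h1 h2; exists h; split=> // y /h2; exact.
have [l1 l2] : B (level T n i) by apply: (@xgetPex _ 0%N B); exists h.
move=> y; apply/idP/idP => [/l2 //|yl].
by apply: leq_trans l1; exact: zigzag_leq.
Qed.

Lemma level_unique T n i h : growing T -> (T (zigzag i h) h <= n)%N ->
  (n < T (zigzag i h.+1) h.+1)%N -> level T n i = h.
Proof.
move=> gT; rewrite levelP // ltnNge levelP // -ltnNge ltnS => a b.
by apply/eqP; rewrite eqn_leq a b.
Qed.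

Lemma snapshot1E T n i :
  (snapshot T n).1 i = if is_cell i (level T n i) then -1 else 1.
Proof.
rewrite /= ffunE /= -/(level T n i) /zigzag.
by case: (is_cell i _); rewrite ?eqxx ?subr1_neq.
Qed.

Lemma snapshot2E T n i :
  (snapshot T n).2 i = (n - T (zigzag i (level T n i)) (level T n i))%N.
Proof. by rewrite /= ffunE. Qed.

(** Columns i and i + 1 share the cells of first coordinate i, so their levels
    pass the rows of these cells simultaneously. *)
Lemma level_shared T n i y : growing T -> is_cell i y ->
  (y <= level T n i)%N = (y <= level T n (i + 1)%R)%N.
Proof.
by move=> gT c; rewrite -!levelP // zigzag_same // zigzag_next.
Qed.

Lemma is_cellD x y k : is_cell x (y + k) = is_cell x y (+) odd k.
Proof. by rewrite /is_cell addnA oddD addNb. Qed.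

(** Two adjacent levels cannot be separated by a row of shared cells, so they
    differ by at most 1, and their parities, which are the values of the front
    line, decide which case occurs. This is the equation
    2 (h (i + 1) - h i) = - (b i + b (i + 1)). *)
Lemma level_add1 T n i : growing T ->
  (level T n (i + 1)%R + ((snapshot T n).1 i == 1%R)
    + ((snapshot T n).1 (i + 1)%R == 1%R)
  = (level T n i).+1)%N.
Proof.
move=> gT; rewrite !snapshot1E is_cell_add1.
set a := level T n i; set b := level T n (i + 1)%R.
have S y : is_cell i y -> (y <= a)%N = (y <= b)%N by exact: level_shared.
have : is_cell i b = is_cell i a (+) odd (a + b).
  rewrite /is_cell !oddD; by case: (odd i); case: (odd a); case: (odd b).
have := S a; have := S b; have := S a.+1; have := S b.+1; have := S a.-1; have := S b.-1.
rewrite !is_cellS.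
have P c : (0 < c)%N -> is_cell i c.-1 = ~~ is_cell i c.
  by case: c => // c _; rewrite is_cellS negbK.
clearbody a b; case: (posnP a) => [->|/(P a) ->]; case: (posnP b) => [->|/(P b) ->];
by repeat match goal with |- context[is_cell i ?c] => case: (is_cell i c) => /= end; lia.
Qed.

End Cylinder.

(** * Deterministic evolution of the front line *)

Section Flips.
Variable L : nat.
Implicit Types (i j : 'Z_(2 * L)) (U V : {set 'Z_(2 * L)}).
Implicit Types s : {ffun 'Z_(2 * L) -> int} * {ffun 'Z_(2 * L) -> nat}.

(** The columns i and i + 1 form a local maximum of the front line: the next
    cell to be added to both of them is the same, and its two predecessors have
    been filled. *)
Definition peak s i : bool := (s.1 i == 1) && (s.1 (i + 1) == -1).

(** Adding the cell above the peak i exchanges the values 1 and -1 at i and i + 1,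
    and the new cell is then on the front line in both columns, with age 0. *)
Definition flip s U : {ffun 'Z_(2 * L) -> int} * {ffun 'Z_(2 * L) -> nat} :=
  ([ffun j => if j \in U then -1 else if j - 1 \in U then 1 else s.1 j],
   [ffun j => if (j \in U) || (j - 1 \in U) then 0%N else (s.2 j).+1]).

Lemma mem_flip s U i : U \subset peak s ->
  (i \in U) = peak s i && ((flip s U).1 i == -1).
Proof.
move=> /fintype.subsetP Us; rewrite ffunE; have := Us i.
case: (i \in U) => [/(_ isT) Pi|_]; first by rewrite (Pi : peak s i).
rewrite /peak.
by case: eqP => //= ->; case: ifP => _; rewrite ?andbF.
Qed.

Lemma flip_inj s U V : U \subset peak s -> V \subset peak s ->
  flip s U = flip s V -> U = V.
Proof. by move=> Us Vs e; apply/setP => i; rewrite (mem_flip _ Us) e -mem_flip. Qed.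

Definition jumps (T : 'Z_(2 * L) -> nat -> nat) (n : nat) : {set 'Z_(2 * L)} :=
  [set i | peak (snapshot T n) i && (T i (level T n i).+1 == n.+1)]%SET.

Lemma jumps_peak T n : jumps T n \subset peak (snapshot T n).
Proof. by apply/fintype.subsetP => i; rewrite inE => /andP[]. Qed.

Hypothesis hL : (0 < L)%N.
Implicit Types T : 'Z_(2 * L) -> nat -> nat.

(** A peak is a cell that waits: its two predecessors are filled and it is not.
    The row of that cell is determined by the level of its column. *)
Lemma peakP T n i y : growing T -> is_cell i y.+1 ->
  (peak (snapshot T n) i && (level T n i == y)) =
  [&& (T (i - 1)%R y <= n)%N, (T (i + 1)%R y <= n)%N & (n < T i y.+1)%N].
Proof.
move=> gT c.
have c0 : ~~ is_cell i y by rewrite -is_cellS.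
have e1 : zigzag i y = i - 1 by rewrite zigzag_pred.
have e2 : zigzag (i + 1) y = i + 1 by rewrite zigzag_same // is_cell_add1.
have e3 : zigzag i y.+1 = i by rewrite zigzag_same.
rewrite -{1}e1 -{1}e2 -[X in T X y.+1]e3 ltnNge !levelP // -ltnNge ltnS.
have sh := level_shared hL n gT c.
have adj := level_add1 hL n i gT.
apply/idP/and3P => [/andP[/andP[/eqP p1 /eqP p2] /eqP <-]|[h1 h2 h3]].
  by move: adj; rewrite p1 p2 /= => adj; split; lia.
have ei : level T n i = y by lia.
rewrite ei eqxx andbT /peak !snapshot1E // is_cell_add1 // ei.
have -> : level T n (i + 1)%R = y by lia.
by rewrite (negbTE c0).
Qed.

Lemma peak_cell T n i : growing T -> peak (snapshot T n) i ->
  [/\ is_cell i (level T n i).+1, level T n (i + 1)%R = level T n i,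
      (T (i - 1)%R (level T n i) <= n)%N, (T (i + 1)%R (level T n i) <= n)%N
    & (n < T i (level T n i).+1)%N].
Proof.
move=> gT pi; have c : is_cell i (level T n i).+1.
  by move: pi; rewrite /peak snapshot1E // is_cellS; case: is_cell.
have := peakP n gT c; rewrite pi eqxx /= => /esym/and3P[a1 a2 a3]; split=> //.
by have := level_add1 hL n i gT; case/andP: pi => /eqP -> /eqP -> /=; lia.
Qed.

(** The evolution of the front line. A cell filled at time n + 1 has its
    predecessors filled strictly before, hence waits at a peak at time n; in
    particular a level rises by at most 1. *)
Lemma snapshotS T n : growing T ->
  snapshot T n.+1 = flip (snapshot T n) (jumps T n).
Proof.
move=> gT; set J := jumps T n.
have crossE i y : is_cell i y.+1 ->
    (T i y.+1 == n.+1) = (i \in J) && (level T n i == y).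
  move=> c; rewrite inE; apply/idP/idP => [/eqP e|/andP[/andP[_ /eqP <-] /eqP ->] //].
  have [lt1 lt2] := gT.2 i y c.
  have := peakP n gT c; rewrite e.
  have -> : [&& (T (i - 1)%R y <= n)%N, (T (i + 1)%R y <= n)%N & (n < n.+1)%N].
    by apply/and3P; split; lia.
  by case/andP => -> /eqP ->; rewrite e !eqxx.
have riseE j : (T (zigzag j (level T n j).+1) (level T n j).+1 == n.+1)
    = (j \in J) || (j - 1 \in J).
  have [c|c] := boolP (is_cell j (level T n j)).
    have -> : j \in J = false.
      by rewrite inE /peak snapshot1E // c.
    have c' : is_cell (j - 1) (level T n j).+1 by rewrite is_cell_sub1 // is_cellS c.
    rewrite zigzag_pred ?is_cellS ?c // crossE //=.
    case: (boolP (j - 1 \in J)) => //; rewrite inE => /andP[/(peak_cell gT)].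
    by rewrite subrK => -[_ -> _ _ _] _; rewrite eqxx.
  have -> : j - 1 \in J = false.
    by rewrite inE /peak subrK [X in _ && (X == -1)]snapshot1E // (negbTE c) andbF.
  by rewrite zigzag_same ?is_cellS // crossE ?is_cellS // eqxx andbT orbF.
have levelS j : level T n.+1 j = (level T n j + ((j \in J) || ((j - 1)%R \in J)))%N.
  have le_n : (T (zigzag j (level T n j)) (level T n j) <= n)%N by rewrite levelP.
  have gt_n : (n < T (zigzag j (level T n j).+1) (level T n j).+1)%N.
    by rewrite ltnNge levelP // -ltnNge.
  rewrite -riseE; case: eqP => e; apply: level_unique; rewrite ?addn1 ?addn0 //; try lia.
  by rewrite -e; exact: zigzag_growing.
have jump_cell j : j \in J -> is_cell j (level T n j) = false.
  by rewrite inE /peak snapshot1E //; case: is_cell.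
have jump_next j : j - 1 \in J -> is_cell j (level T n j).
  by rewrite inE /peak subrK [X in _ && (X == -1)]snapshot1E //; case: is_cell; rewrite ?andbF.
rewrite [LHS]surjective_pairing /flip; congr (_, _); apply/ffunP => j.
  rewrite [RHS]ffunE !snapshot1E // levelS is_cellD.
  have [/jump_cell -> //|_] /= := boolP (j \in J).
  by have [/jump_next -> //|_] := boolP (j - 1 \in J); rewrite addbF.
rewrite [RHS]ffunE !snapshot2E // levelS -riseE.
case: eqP => e; first by rewrite addn1 e subnn.
by rewrite addn0 subSn // levelP.
Qed.

End Flips.

(** * Front lines of growing passage times *)

Section Snapshots.
Variables (L : nat) (hL : (0 < L)%N).
Implicit Types (i j x : 'Z_(2 * L)) (U : {set 'Z_(2 * L)}).
Implicit Types T : 'Z_(2 * L) -> nat -> nat.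

(** The increments of the levels sum to 0 around the cylinder, and so do the
    values of the front line; the conditions on the ages say that the times grow
    along two adjacent columns. *)
Lemma snapshot_timed_bridge T n : growing T -> timed_bridges L (snapshot T n).
Proof.
move=> gT; have b01 i : (snapshot T n).1 i = -1 \/ (snapshot T n).1 i = 1.
  by rewrite snapshot1E //; case: ifP; [left|right].
have le_n i : (T (zigzag i (level T n i)) (level T n i) <= n)%N by rewrite levelP.
split; [split=> //|move=> i].
  have e i : (snapshot T n).1 i + (snapshot T n).1 (i + 1) =
      2 * (level T n i)%:Z - 2 * (level T n (i + 1))%:Z.
    have := level_add1 hL n i gT.
    by case: (b01 i) => ->; case: (b01 (i + 1)) => -> /=; lia.
  have : \sum_i ((snapshot T n).1 i + (snapshot T n).1 (i + 1)) = 0.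
    apply/eqP; rewrite (eq_bigr _ (fun i _ => e i)) sumrB subr_eq0; apply/eqP.
    by rewrite [LHS](reindex_inj (addIr 1)).
  have -> : \sum_i ((snapshot T n).1 i + (snapshot T n).1 (i + 1)) =
      \sum_i (snapshot T n).1 i + \sum_i (snapshot T n).1 i.
    by rewrite big_split /=; congr (_ + _); rewrite [RHS](reindex_inj (addIr 1)).
  by lia.
have := level_add1 hL n i gT; have := le_n i; have := le_n (i + 1).
rewrite !snapshot2E.
have is1 j : (snapshot T n).1 j = 1 -> is_cell j (level T n j) = false.
  by rewrite snapshot1E //; case: ifP.
have isN1 j : (snapshot T n).1 j = -1 -> is_cell j (level T n j).
  by rewrite snapshot1E //; case: ifP.
move=> l1 l2 adj; split=> b1 b2; move: adj; rewrite b1 b2 /=.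
- move=> adj; have e : level T n i = (level T n (i + 1)%R).+1 by lia.
  have c := is1 _ b1; rewrite e is_cellS in c.
  move/negbFE: c => c; move: l1 l2 (zigzag_growing hL i (level T n (i + 1)%R) gT).
  by rewrite e (zigzag_next hL c) (zigzag_same c); lia.
- move=> adj; have e : level T n (i + 1)%R = (level T n i).+1 by lia.
  have c := isN1 _ b1.
  move: l1 l2 (zigzag_growing hL (i + 1) (level T n i) gT).
  by rewrite e (zigzag_next hL c) (zigzag_same c); lia.
- move=> adj; have e : level T n (i + 1)%R = level T n i by lia.
  by rewrite e zigzag_next ?zigzag_same ?isN1.
Qed.

Definition flat : {ffun 'Z_(2 * L) -> int} * {ffun 'Z_(2 * L) -> nat} :=
  ([ffun i => if is_cell i 0 then -1 else 1], [ffun=> 0%N]).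

Lemma snapshot_flat T n y : growing T -> ~~ odd y ->
  (forall x, is_cell x y -> T x y = n) -> snapshot T n = flat.
Proof.
move=> gT ey Ty.
have Tz i : T (zigzag i y) y = n by apply: Ty; exact: zigzag_cell.
have lev i : level T n i = y.
  by apply: level_unique; rewrite ?Tz // -[X in (X < _)%N](Tz i) zigzag_growing.
rewrite [LHS]surjective_pairing; congr (_, _); apply/ffunP => i.
  by rewrite [RHS]ffunE snapshot1E // lev -{1}[y]add0n is_cellD (negbTE ey) addbF.
by rewrite [RHS]ffunE snapshot2E // lev Tz subnn.
Qed.

Lemma snapshot0 T : growing T -> snapshot T 0 = flat.
Proof.
move=> gT; apply: (snapshot_flat (y := 0%N)) => // x c; exact: row0_growing.
Qed.

(** Passage times above n count as not yet known at time n. *)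
Definition agree (n : nat) T T' : Prop :=
  forall x y, is_cell x y -> minn (T x y) n.+1 = minn (T' x y) n.+1.

Lemma agree_level n k T T' i : growing T -> growing T' -> agree n T T' ->
  (k <= n)%N -> level T k i = level T' k i.
Proof.
move=> gT gT' a kn.
have e y : (y <= level T k i)%N = (y <= level T' k i)%N.
  rewrite -!levelP //; have := a _ _ (zigzag_cell hL i y); lia.
by apply/eqP; rewrite eqn_leq -e leqnn e leqnn.
Qed.

Lemma agree_snapshot n k T T' : growing T -> growing T' -> agree n T T' ->
  (k <= n)%N -> snapshot T k = snapshot T' k.
Proof.
move=> gT gT' a kn; have lev i := agree_level i gT gT' a kn.
rewrite [LHS]surjective_pairing [RHS]surjective_pairing.
congr (_, _); apply/ffunP => i; first by rewrite !snapshot1E // lev.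
rewrite !snapshot2E // -lev.
have := a _ _ (zigzag_cell hL i (level T k i)).
have : (T (zigzag i (level T k i)) (level T k i) <= k)%N by rewrite levelP.
by lia.
Qed.

(** The front line alone, without ages, records when the levels rise, because a
    rise by 1 changes the parity of a level. *)
Lemma level_succ T n i : growing T -> level T n.+1 i =
  (level T n i + ((snapshot T n.+1).1 i != (snapshot T n).1 i))%N.
Proof.
move=> gT; set h := level T n i.
have h1 : (h <= level T n.+1 i)%N by rewrite -levelP // leqW // levelP.
have h2 : (level T n.+1 i <= h.+1)%N.
  rewrite leqNgt -levelP // -ltnNge.
  apply: leq_ltn_trans _ (zigzag_growing hL _ _ gT).
  by rewrite ltnNge levelP // -ltnNge.
rewrite !snapshot1E // -/h.
have [e|/eqP ne] := (level T n.+1 i =P h); first by rewrite e eqxx addn0.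
have -> : level T n.+1 i = h.+1 by lia.
by rewrite is_cellS; case: is_cell => //=; rewrite addn1.
Qed.

(** Hence the trajectory of the front line up to time n determines all passage
    times up to n. *)
Lemma snapshot_agree n T T' : growing T -> growing T' ->
  (forall k, (k <= n)%N -> (snapshot T k).1 = (snapshot T' k).1) -> agree n T T'.
Proof.
move=> gT gT' e x y c.
have lev k i : (k <= n)%N -> level T k i = level T' k i.
  elim: k => [_|k IH kn]; last first.
    by rewrite !level_succ // IH ?e // ltnW.
  have lev0 S : growing S -> level S 0 i = 0%N.
    move=> gS; apply: level_unique => //; last exact: zigzag_ge.
    by rewrite (row0_growing gS (zigzag_cell hL _ _)).
  by rewrite !lev0.
have E k : (k <= n)%N -> (T x y <= k)%N = (T' x y <= k)%N.
  by move=> kn; rewrite -(zigzag_same c) !levelP // lev.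
have := E (T x y); have := E (T' x y); have := E n.
by rewrite !leqnn => /(_ isT) h1 h2 h3; lia.
Qed.

(** Any cell that is not filled at time n may be delayed, together with the cells
    above it, so the flips at time n + 1 can be prescribed at will. *)
Lemma jumps_extension T n U : growing T -> U \subset peak (snapshot T n) ->
  exists T', [/\ growing T', agree n T T' & jumps T' n = U].
Proof.
move=> gT /fintype.subsetP Us.
pose T' x y := if (T x y <= n)%N then T x y else
  if (x \in U) && (y == (level T n x).+1) then n.+1 else (n.+1 + y)%N.
have T'_le x y : (T' x y <= n.+1 + y)%N.
  by rewrite /T'; case: ifP; [|case: ifP]; lia.
have gT' : growing T'.
  split=> [x c|x y c]; first by rewrite /T' row0_growing.
  have [l1 l2] := gT.2 x y c; rewrite {2 4}/T'.
  case: ifP => [Tn|_]; first by rewrite /T' !ifT //; lia.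
  case: ifP => [/andP[/Us/(peak_cell hL gT)[_ _ h1 h2 _] /eqP [->]]|_].
    by rewrite /T' !ifT.
  by have := T'_le (x - 1) y; have := T'_le (x + 1) y; lia.
have a : agree n T T'.
  move=> x y _; rewrite /T'; case: (leqP (T x y) n) => // h; case: (_ && _); lia.
exists T'; split=> //; apply/setP => i; rewrite inE.
rewrite -(agree_snapshot gT gT' a) // -(agree_level _ gT gT' a) //.
have [Ui|nUi] := boolP (i \in U).
  have pi := Us i Ui; rewrite (pi : peak (snapshot T n) i) /T' Ui eqxx /=.
  by have [_ _ _ _] := peak_cell hL gT pi; rewrite ltnNge => /negbTE ->; rewrite eqxx.
apply/andP => -[/(peak_cell hL gT)[_ _ _ _ h] /eqP].
by rewrite /T' (negbTE nUi) leqNgt h /=; lia.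
Qed.

(** From time n on, every peak flips at every unit of time. *)
Fixpoint eager (n : nat) T (x : 'Z_(2 * L)) (y : nat) : nat :=
  if y is y'.+1 then
    if (T x y <= n)%N then T x y
    else (maxn n (maxn (eager n T (x - 1) y') (eager n T (x + 1) y'))).+1
  else T x y.

Lemma eager_early n T x y : growing T -> is_cell x y ->
  (T x y <= n)%N -> eager n T x y = T x y.
Proof. by case: y => //= y _ _ ->. Qed.

Lemma eager_late n T x y : growing T -> is_cell x y ->
  (n < T x y)%N -> (n < eager n T x y)%N.
Proof.
case: y => [gT c|y gT c h]; first by rewrite row0_growing.
by rewrite /= ifN -?ltnNge //; lia.
Qed.

Lemma eager_agree n T : growing T -> agree n T (eager n T).
Proof.
move=> gT x y c; have [h|h] := leqP (T x y) n; first by rewrite eager_early.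
by have := eager_late gT c h; lia.
Qed.

Lemma eager_growing n T : growing T -> growing (eager n T).
Proof.
move=> gT; split=> [x c|x y c]; first exact: gT.1.
have [l1 l2] := gT.2 x y c.
have c1 : is_cell (x - 1) y by rewrite is_cell_sub1 // -is_cellS.
have c2 : is_cell (x + 1) y by rewrite is_cell_add1 // -is_cellS.
rewrite [X in (_ < X)%N /\ (_ < X)%N]/=; case: ifP => h; last by lia.
by rewrite !eager_early //; lia.
Qed.

Lemma eager_next n T x y k : growing T -> is_cell x y.+1 -> (n <= k)%N ->
  (eager n T (x - 1)%R y <= k)%N -> (eager n T (x + 1)%R y <= k)%N ->
  (eager n T x y.+1 <= k.+1)%N.
Proof. by move=> gT c; rewrite /=; case: ifP; lia. Qed.

Lemma eager_jumps n T k : growing T -> (n <= k)%N ->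
  jumps (eager n T) k = [set i | peak (snapshot (eager n T) k) i]%SET.
Proof.
move=> gT nk; apply/setP => i; rewrite !inE; case: (boolP (peak _ _)) => //.
move=> /(peak_cell hL (eager_growing n gT))[c _ h1 h2 h3].
by have := eager_next gT c nk h1 h2; lia.
Qed.

(** Let m be the lowest level at time n. All rows up to m are filled, so eager
    filling completes row m + k by time n + k. On the other hand a cell of row
    m + 1 was empty at time n; the cells above it wait for it, and after L rows
    they cover the whole cylinder. So row m + k is filled exactly at time n + k
    for all k >= L, whatever the shape was. *)
Lemma eager_flat n T : growing T ->
  exists2 k, ((k == L) || (k == L.+1)) & snapshot (eager n T) (n + k) = flat.
Proof.
move=> gT; set E := eager n T; have gE : growing E by exact: eager_growing.
have [i0 _ min_i0] := arg_minnP (fun i => level T n i) (erefl : xpredT (0 : 'Z_(2 * L))).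
set m := level T n i0 in min_i0.
have upper k x y : is_cell x y -> (y <= m + k)%N -> (E x y <= n + k)%N.
  elim: k x y => [|k IH] x y c h.
    have Txy : (T x y <= n)%N.
      rewrite -(zigzag_same c) levelP //; have := min_i0 x isT; lia.
    by rewrite /E eager_early //; lia.
  case: y c h => [|y] c h; first by rewrite (row0_growing gE c).
  have c1 : is_cell (x - 1) y by rewrite is_cell_sub1 // -is_cellS.
  have c2 : is_cell (x + 1) y by rewrite is_cell_add1 // -is_cellS.
  rewrite addnS; apply: eager_next => //; first by lia.
    by apply: IH => //; lia.
  by apply: IH => //; lia.
pose x0 := zigzag i0 m.+1.
have c0 : is_cell x0 m.+1 by exact: zigzag_cell.
(* The cells of row m + 1 + k that sit above the empty cell [x0]. *)
have cellj k (j : nat) : is_cell (x0 - k%:R + (2 * j)%:R) (m.+1 + k).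
  by rewrite /is_cell oddD !(odd_addr, odd_oppr, odd_natr) // oddD oddM /=; move: c0;
    rewrite /is_cell oddD /=; case: (odd x0); case: (odd m); case: (odd k).
have lower k (j : nat) : (j <= k)%N -> (n + k < E (x0 - k%:R + (2 * j)%:R)%R (m.+1 + k)%N)%N.
  elim: k j => [|k IH] j.
    rewrite leqn0 => /eqP ->; rewrite muln0 subr0 addr0 !addn0.
    by apply: eager_late => //; rewrite ltnNge levelP // ltnn.
  move=> jk; have c := cellj k.+1 j; rewrite addnS in c.
  have [l1 l2] := gE.2 _ _ c; rewrite [X in E _ X]addnS addnS.
  have [j_le|j_gt] := leqP j k.
    apply: leq_ltn_trans _ l2.
    have -> : x0 - k.+1%:R + (2 * j)%:R + 1 = x0 - k%:R + (2 * j)%:R :> 'Z_(2 * L).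
      by rewrite -natr1; ring.
    exact: IH.
  apply: leq_ltn_trans _ l1.
  have -> : x0 - k.+1%:R + (2 * j)%:R - 1 = x0 - k%:R + (2 * k)%:R :> 'Z_(2 * L).
    have -> : j = k.+1 by lia.
    by rewrite mulnS natrD -natr1; ring.
  exact: IH.
have row_flat k : (L <= k)%N -> forall x, is_cell x (m + k) -> E x (m + k)%N = (n + k)%N.
  case: k => [|k] Lk x c; first by lia.
  apply/eqP; rewrite eqn_leq upper //=.
  pose e : 'Z_(2 * L) := x - x0 + k%:R.
  have ev : odd e = false.
    rewrite !(odd_addr, odd_oppr, odd_natr) //; move: c c0.
    by rewrite /is_cell !oddD /=; case: (odd x); case: (odd x0); case: (odd m); case: (odd k).
  have e2 : (e = 2 * (e./2) :> nat)%N by have := odd_double_half e; rewrite ev; lia.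
  have lt_e : (e < 2 * L)%N by rewrite -[X in (_ < X)%N]card_cylinder.
  have := lower k (e./2); rewrite -e2 natr_Zp addnS addSn addnS.
  have -> : x0 - k%:R + e = x by rewrite /e; ring.
  by apply; lia.
(* [flat] is the front line of an even row, so m + k has to be even. *)
pose k := (L + odd (m + L))%N.
exists k; first by rewrite /k; case: odd; rewrite ?addn1 ?addn0 eqxx ?orbT.
apply: (snapshot_flat gE (y := (m + k)%N)); last by apply: row_flat; exact: leq_addr.
by rewrite /k addnA oddD oddb addbb.
Qed.

End Snapshots.

(** * Realisation of timed bridges *)

Section Realisation.
Variables (L : nat) (hL : (0 < L)%N).
Implicit Types (i j x : 'Z_(2 * L)).

Lemma val_subr1 x : x != 0 -> (x - 1)%R = x.-1 :> nat.
Proof.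
move=> x0; have {}x0 : (0 < x)%N by rewrite lt0n.
have lt_x : (x < 2 * L)%N by rewrite -[X in (_ < X)%N]card_cylinder.
rewrite -[x in LHS]natr_Zp -[in LHS](prednK x0) -natr1 addrK.
by rewrite val_Zp_nat ?modn_small //; lia.
Qed.

(** A closed path of steps 1 and -1 bounds a pile of cells whose topmost cell of
    abscissa x lies in row v x. The rows v x are positive so that no cell of row
    0, whose passage time has to be 0, is topmost. *)
Lemma bridge_profile (b : {ffun 'Z_(2 * L) -> int}) : bridges L b ->
  exists v : 'Z_(2 * L) -> nat, forall x,
    [/\ (0 < v x)%N, is_cell x (v x) &
        (v x + (b x == 1%R) = v (x - 1)%R + (b x == - 1%R))%N].
Proof.
move=> [b1 b0]; pose neg x : nat := b x == -1.
have bE x : b x = 1 - 2 * (neg x)%:Z by rewrite /neg; case: (b1 x) => ->.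
have card : (Zp_trunc (2 * L)).+2 = (2 * L)%N by exact: card_cylinder.
have total : (\sum_x neg x = L)%N.
  move: b0; rewrite (eq_bigr _ (fun x _ => bE x)) sumrB sumr_const card_ord.
  rewrite -mulr_sumr -(big_morph Posz PoszD (erefl 0%:Z)).
  move: (\sum_x neg x)%N => t; rewrite natz card; lia.
pose c x := (\sum_(i : 'Z_(2 * L) | (i <= x)%N) neg i)%N.
have cS x : x != 0 -> c x = (c (x - 1)%R + neg x)%N.
  move=> x0; rewrite /c val_subr1 // (bigD1 x) //= addnC; congr (_ + _)%N.
  apply: eq_bigl => i; rewrite -(inj_eq val_inj) /=.
  have {}x0 : (0 < x)%N by rewrite lt0n.
  lia.
have c0 : c 0 = neg 0.
  rewrite /c (big_pred1 0) // => i; rewrite /= leqn0.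
  by rewrite -(inj_eq val_inj).
have vN : (0 - 1 : 'Z_(2 * L))%R = (2 * L).-1 :> nat.
  have -> : (0 - 1 : 'Z_(2 * L))%R = ((2 * L).-1)%:R.
    apply/eqP; rewrite subr_eq natr1 prednK; last by lia.
    by rewrite pchar_Zp //; lia.
  by rewrite val_Zp_nat ?modn_small; lia.
have cN : c (0 - 1) = L.
  rewrite /c vN -[RHS]total; apply: eq_bigl => i.
  by have := ltn_ord i; rewrite [X in (_ < X)%N]card; lia.
(* This is 2 L + 1 minus the partial sum of b up to x, written so as to stay
   in the natural numbers. *)
exists (fun x => 1 + (2 * L - x.+1) + 2 * c x)%N => x.
have lt_x : (x < 2 * L)%N by rewrite -[X in (_ < X)%N]card.
split; first by lia.
  rewrite /is_cell; lia.
have -> : (b x == 1) = ~~ (b x == -1) by case: (b1 x) => ->.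
have [->|x0] := eqVneq x 0.
  rewrite c0 cN vN /neg; case: eqP => _ /=; lia.
rewrite cS // val_subr1 // /neg; have {}x0 : (0 < x)%N by rewrite lt0n.
by case: eqP => _; lia.
Qed.

(** The ages prescribe the passage times of the cells on the front line, and the
    conditions on the ages are exactly the growth conditions between them. The
    other cells of the pile may be filled long before, at the time given by
    their row, and the cells outside the pile after time N. *)
Lemma timed_bridge_snapshot (s : {ffun 'Z_(2 * L) -> int} * {ffun 'Z_(2 * L) -> nat}) :
  timed_bridges L s ->
  exists N0, forall N, (N0 <= N)%N -> exists2 T, growing T & snapshot T N = s.
Proof.
case: s => b t [/= b_bridge b_ages]; have b1 := b_bridge.1.
have [v vP] := bridge_profile b_bridge.
exists (\sum_x t x + \sum_x v x).+1 => N N_ge.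
have N_big x z : (v x + t z < N)%N.
  apply: leq_trans N_ge; rewrite ltnS addnC leq_add //.
    by rewrite (bigD1 z) //= leq_addr.
  by rewrite (bigD1 x) //= leq_addr.
pose T x y := if (v x < y)%N then (N + y)%N else if (y < v x)%N then y
  else if b x == -1 then (N - t x)%N
  else if b (x + 1) == 1 then (N - t (x + 1)%R)%N else y.
have T_le x y : (T x y <= N + y)%N.
  by rewrite /T; do ![case: ifP => _]; lia.
have T_ge x y : (y <= T x y)%N.
  have N1 := N_big x x; have N2 := N_big x (x + 1).
  by rewrite /T; case: ltngtP => // h; do ?[case: ifP => _]; lia.
have T_below x y : (y < v x)%N -> T x y = y.
  by move=> h; rewrite /T ltnNge (ltnW h) h.
have T_above x y : (v x < y)%N -> T x y = (N + y)%N by rewrite /T => ->.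
have T_on x : T x (v x) = if b x == -1 then (N - t x)%N else
    if b (x + 1) == 1 then (N - t (x + 1)%R)%N else v x by rewrite /T ltnn.
have T_leN x y : (T x y <= N)%N = (y <= v x)%N.
  case: (ltngtP y (v x)) => [h|h|->]; first by rewrite T_below //; have := N_big x x; lia.
    by rewrite T_above //; have [] := vP x; lia.
  by have N1 := N_big x x; rewrite T_on; do ?[case: ifP => _]; lia.
have gT : growing T.
  split=> [x c|x y c]; first by rewrite T_below //; case: (vP x).
  have [h|h|e] := ltngtP y.+1 (v x).
  - rewrite (T_below x) //; have [_ _ e1] := vP x; have [_ _] := vP (x + 1).
    rewrite addrK => e2; rewrite !T_below //.
      by case: (b1 (x + 1)) e2 => -> /=; lia.
    by case: (b1 x) e1 => -> /=; lia.
  - by rewrite (T_above x) //; have := T_le (x - 1) y; have := T_le (x + 1) y; lia.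
  have [_ _ e1] := vP x; have [_ _] := vP (x + 1); rewrite addrK => e2.
  have T_ge_x : (y < T x (v x))%N by rewrite e.
  rewrite e; split.
    case: (b1 x) e1 => bx; rewrite bx /= => e1; last by rewrite T_below //; lia.
    have -> : y = v (x - 1) by lia.
    rewrite T_on [X in (_ < X)%N]T_on bx subrK bx /=.
    have [_ + _] := b_ages (x - 1); rewrite subrK => bt.
    case: eqP => [b'|_]; last by have := N_big (x - 1) x; lia.
    by have := bt b' bx; have := N_big x (x - 1); lia.
  case: (b1 (x + 1)) e2 => bx; rewrite bx /= => e2; first by rewrite T_below //; lia.
  have -> : y = v (x + 1) by lia.
  have -> : T x (v x) = (N - t (x + 1)%R)%N.
    rewrite T_on bx /=; case: eqP => // b'.
    by have [_ _ ->] := b_ages x.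
  rewrite T_on bx /=; have [bt _ _] := b_ages (x + 1).
  case: eqP => [b'|_]; last by have := N_big (x + 1) (x + 1); lia.
  by have := bt bx b'; have := N_big x (x + 1 + 1); lia.
exists T => //.
have top i : b i = -1 -> level T N i = v i.
  move=> bi; have [_ c e] := vP i; apply: level_unique => //.
    by rewrite zigzag_same // T_leN.
  by rewrite ltnNge zigzag_pred ?is_cellS ?c // T_leN; move: e; rewrite bi /=; lia.
have top' i : b i = 1 -> level T N i = v (i - 1).
  move=> bi; have [_ c e] := vP i; have [_ c' _] := vP (i - 1).
  rewrite is_cell_sub1 // in c'; apply: level_unique => //.
    by rewrite zigzag_pred // T_leN.
  by rewrite ltnNge zigzag_same ?is_cellS // T_leN; move: e; rewrite bi /=; lia.
rewrite [LHS]surjective_pairing; congr (_, _); apply/ffunP => i.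
  rewrite snapshot1E //; have [_ c _] := vP i; have [_ c' _] := vP (i - 1).
  case: (b1 i) => bi; rewrite bi; first by rewrite top // c.
  by rewrite top' //; move: c'; rewrite is_cell_sub1 // => /negbTE ->.
rewrite snapshot2E //; have [_ c _] := vP i; have [_ c' _] := vP (i - 1).
have N1 := N_big i i.
case: (b1 i) => bi; first by rewrite top // zigzag_same // T_on bi eqxx; rewrite /=; lia.
rewrite is_cell_sub1 // in c'; rewrite top' // zigzag_pred // T_on subrK bi eqxx.
rewrite /=; case: eqP => [b'|_]; last by lia.
have [_ _] := b_ages (i - 1); rewrite subrK => /(_ b' bi) ->; lia.
Qed.

End Realisation.

(** * Doeblin's condition *)

Section Doeblin.
Context {R : realType} {E : countType}.
Implicit Types (S : set E) (Q : E -> E -> R) (s u v : E).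
Local Open Scope ereal_scope.

Lemma esumZl (I : set E) (a : E -> \bar R) (r : R) : (0 <= r)%R ->
  (forall i, I i -> 0 <= a i) ->
  \esum_(i in I) (r%:E * a i) = r%:E * \esum_(i in I) a i.
Proof.
move=> r0 a0; rewrite /esum -ereal_supZl //; last first.
  by apply/set0P; exists 0; exists set0; [exact: fsets_set0|rewrite fsbig_set0].
have scale X : fsets I X ->
    \sum_(i \in X) (r%:E * a i) = r%:E * \sum_(i \in X) a i.
  move=> [finX XI]; rewrite !fsbig_finite // !big_seq ge0_sume_distrr // => i.
  by rewrite in_fset_set // inE => /XI/a0.
congr ereal_sup; apply/seteqP; split=> [_ [X IX <-]|_ [_ [X IX <-] <-]].
  by exists (\sum_(i \in X) a i); [exists X|rewrite scale].
by exists X => //; rewrite scale.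
Qed.

Section Kernel.
Variables (S : set E) (Q : E -> E -> R).
Hypothesis hQ : stochastic S Q.

Let Q0 u v : S u -> S v -> 0 <= (Q u v)%:E.
Proof. by move=> Su Sv; rewrite lee_fin; exact: hQ.1. Qed.

Lemma kernel_pow_ge0 n u v : S u -> S v -> 0 <= kernel_pow S Q n u v.
Proof.
elim: n u => [|n IH] u Su Sv /=; first by rewrite lee_fin.
by apply: esum_ge0 => x Sx; apply: mule_ge0; [exact: Q0|exact: IH].
Qed.

Lemma kernel_pow_le1 n u v : S u -> S v -> kernel_pow S Q n u v <= 1.
Proof.
elim: n u => [|n IH] u Su Sv /=; first by case: eqP.
rewrite -(hQ.2 _ Su); apply: le_esum => x Sx.
by rewrite -[leRHS]mule1; apply: lee_wpmul2l; [exact: Q0|exact: IH].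
Qed.

Lemma kernel_pow_fin n u v : S u -> S v -> kernel_pow S Q n u v \is a fin_num.
Proof.
move=> Su Sv; rewrite ge0_fin_numE; last exact: kernel_pow_ge0.
exact: le_lt_trans (kernel_pow_le1 n Su Sv) (ltry _).
Qed.

(** Half of the Chapman-Kolmogorov equation *)
Lemma kernel_pow_mul_le n k u v s : S u -> S v -> S s ->
  kernel_pow S Q n u v * kernel_pow S Q k v s <= kernel_pow S Q (n + k) u s.
Proof.
move=> Su Sv Ss; elim: n u Su => [|n IH] u Su.
  rewrite /= add0n; case: eqP => [->|_]; first by rewrite mul1e.
  by rewrite mul0e; exact: kernel_pow_ge0.
rewrite addSn /= muleC -(fineK (kernel_pow_fin k Sv Ss)) -esumZl.
- apply: le_esum => x Sx; rewrite fineK ?kernel_pow_fin // muleCA.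
  by apply: lee_wpmul2l; [exact: Q0|rewrite muleC; exact: IH].
- by apply: fine_ge0; exact: kernel_pow_ge0.
- by move=> x Sx; apply: mule_ge0; [exact: Q0|exact: kernel_pow_ge0].
Qed.

Lemma kernel_powS_ge n u v s : S u -> S v -> S s ->
  (Q u v)%:E * kernel_pow S Q n v s <= kernel_pow S Q n.+1 u s.
Proof.
move=> Su Sv Ss /=; apply: esum_ge; exists [set v]; last by rewrite fsbig_set1.
by split; [exact: finite_set1|move=> x ->].
Qed.

(** Expectation of g one step later, on the event that s is avoided *)
Definition taboo s (g : E -> \bar R) u : \bar R :=
  \esum_(v in S `\ s) ((Q u v)%:E * g v).

(** Probability that s is not visited at times 1 to n *)
Definition survival s n : E -> \bar R := iter n (taboo s) (fun=> 1).

Lemma esum_taboo s g u : S s -> S u -> (forall v, S v -> 0 <= g v) ->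
  \esum_(v in S) ((Q u v)%:E * g v) = (Q u s)%:E * g s + taboo s g u.
Proof.
move=> Ss Su g0; rewrite (esumID [set s]); last first.
  by move=> v Sv; apply: mule_ge0; [exact: Q0|exact: g0].
rewrite -setDE; congr (_ + _); have -> : S `&` [set s] = [set s].
  by apply/seteqP; split=> [x []|x ->].
by rewrite esum_set1 // mule_ge0 // ?Q0 // g0.
Qed.

Lemma taboo_ge0 s g u : S u -> (forall v, S v -> 0 <= g v) -> 0 <= taboo s g u.
Proof.
move=> Su g0; apply: esum_ge0 => v [Sv _].
by apply: mule_ge0; [exact: Q0|exact: g0].
Qed.

Lemma survival_ge0 s n u : S u -> 0 <= survival s n u.
Proof. by elim: n u => [|n IH] u Su //=; apply: taboo_ge0. Qed.

Lemma first_passage_ge0 s n u : S s -> S u -> 0 <= first_passage S Q n u s.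
Proof.
move=> Ss; elim: n u => [|n IH] u Su /=; first exact: Q0.
by apply: esum_ge0 => v [Sv _]; apply: mule_ge0; [exact: Q0|exact: IH].
Qed.

Lemma survival_first_passage s n u : S s -> S u ->
  survival s n u = first_passage S Q n u s + survival s n.+1 u.
Proof.
move=> Ss; elim: n u => [|n IH] u Su.
  have := esum_taboo (g := fun=> 1) Ss Su (fun _ _ => lee01).
  by rewrite mule1 => <-; under eq_esum do rewrite mule1; rewrite hQ.2.
rewrite [LHS]/= [first_passage _ _ _ _ _]/=; rewrite [X in _ + X]/= -esumD.
- apply: eq_esum => v [Sv _]; rewrite IH // ge0_muleDr //.
    exact: first_passage_ge0.
  exact: survival_ge0.
- by move=> v [Sv _]; apply: mule_ge0; [exact: Q0|exact: first_passage_ge0].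
- by move=> v [Sv _]; apply: mule_ge0; [exact: Q0|exact: (survival_ge0 s n.+1)].
Qed.

Lemma survival_noninc s n u : S s -> S u -> survival s n.+1 u <= survival s n u.
Proof.
by move=> Ss Su; rewrite [leRHS]survival_first_passage // leeDr // first_passage_ge0.
Qed.

Lemma survival_le1 s n u : S s -> S u -> survival s n u <= 1.
Proof.
by move=> Ss Su; elim: n => // n; apply: le_trans; exact: survival_noninc.
Qed.

(** Being at s at time n is incompatible with having avoided s until then. The
    start does not count as a visit, which excludes n = 0 and u = s. *)
Lemma survival_kernel_pow s n u : S s -> S u -> (0 < n)%N || (u != s) ->
  survival s n u + kernel_pow S Q n u s <= 1.
Proof.
move=> Ss; elim: n u => [|n IH] u Su.
  by move=> /= /negbTE ->; rewrite adde0.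
move=> _; rewrite /= (esum_taboo (g := fun v => kernel_pow S Q n v s) Ss Su); last first.
  by move=> v Sv; exact: kernel_pow_ge0.
rewrite addeCA -esumD.
- rewrite -[leRHS](hQ.2 _ Su); under [leRHS]eq_esum do rewrite -[(Q _ _)%:E]mule1.
  rewrite [leRHS](esum_taboo (g := fun=> 1) Ss Su) //; apply: leeD.
    by apply: lee_wpmul2l; [exact: Q0|exact: kernel_pow_le1].
  apply: le_esum => v [Sv vs].
  rewrite -ge0_muleDr ?survival_ge0 ?kernel_pow_ge0 //.
  apply: lee_wpmul2l; first exact: Q0.
  by apply: IH => //; apply/orP; right; apply/eqP.
- by move=> v [Sv _]; apply: mule_ge0; [exact: Q0|exact: survival_ge0].
- by move=> v [Sv _]; apply: mule_ge0; [exact: Q0|exact: kernel_pow_ge0].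
Qed.

Lemma survival_scale s g (c : R) n u : (0 <= c)%R -> S u ->
  (forall v, S v -> 0 <= g v <= c%:E) ->
  0 <= iter n (taboo s) g u <= c%:E * survival s n u.
Proof.
move=> c0; elim: n u => [|n IH] u Su gc; first by rewrite mule1 gc.
apply/andP; split.
  by apply: taboo_ge0 => // v Sv; have /andP[] := IH v Sv gc.
rewrite /= /taboo -esumZl //; last first.
  by move=> v [Sv _]; apply: mule_ge0; [exact: Q0|exact: survival_ge0].
apply: le_esum => v [Sv _]; rewrite muleCA.
by apply: lee_wpmul2l; [exact: Q0|have /andP[] := IH v Sv gc].
Qed.

(** Every block of m steps starts afresh and has a chance at least q to end at s,
    so the time of the first visit to s is dominated by a geometric law. *)
Lemma doeblin_survival s m (q : R) : S s -> (0 < m)%N -> (0 < q)%R ->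
  (forall u, S u -> q%:E <= kernel_pow S Q m u s) ->
  forall j u, S u -> survival s (j * m) u <= ((1 - q) ^+ j)%:E.
Proof.
move=> Ss m0 q0 hq j; have q1 : (q <= 1)%R.
  by rewrite -lee_fin (le_trans (hq s Ss)) // kernel_pow_le1.
have surv_m u : S u -> survival s m u <= (1 - q)%:E.
  move=> Su; rewrite EFinB leeBrDr //.
  have : survival s m u + kernel_pow S Q m u s <= 1.
    by apply: survival_kernel_pow; rewrite ?m0.
  by apply: le_trans; rewrite leeD2l // hq.
elim: j => [|j IH] u Su; first by rewrite mul0n expr0.
rewrite mulSn /survival iterD.
have bound v : S v -> 0 <= survival s (j * m) v <= ((1 - q) ^+ j)%:E.
  by move=> Sv; rewrite survival_ge0 //= IH.
have c0 : (0 <= (1 - q) ^+ j)%R by rewrite exprn_ge0 // subr_ge0.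
have /andP[_] := survival_scale s m c0 Su bound.
move=> /le_trans; apply; rewrite exprSr EFinM.
by apply: lee_wpmul2l; [rewrite lee_fin|exact: surv_m].
Qed.

End Kernel.

(** Doeblin's condition, for every state s and every large enough number of
    steps. Two consecutive numbers of steps give aperiodicity, and the geometric
    bound on the survival probabilities gives a finite mean return time, because
    this mean is their sum. *)
Lemma doeblin_ergodic S Q : stochastic S Q ->
  (forall s, S s -> exists n0, forall n, (n0 <= n)%N ->
     exists2 q : R, (0 < q)%R & forall u, S u -> q%:E <= kernel_pow S Q n u s) ->
  ergodic_kernel S Q.
Proof.
move=> hQ doeblin; split.
- move=> s s' Ss Ss'; have [n0 /(_ n0 (leqnn _))[q q0 hq]] := doeblin s' Ss'.
  by exists n0; apply: lt_le_trans (hq s Ss); rewrite lte_fin.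
- move=> s Ss d dvd; have [n0 hn0] := doeblin s Ss.
  have dvd_n n : (n0 < n)%N -> (d %| n)%N.
    move=> n0n; apply: dvd; first by apply: leq_ltn_trans n0n.
    have [q q0 hq] := hn0 n (ltnW n0n).
    by apply: lt_le_trans (hq s Ss); rewrite lte_fin.
  apply/eqP; rewrite -dvdn1 -(@dvdn_addr n0.+1) ?dvd_n //.
  by rewrite addn1.
move=> s Ss; have [n0 /(_ n0.+1 (leqnSn _))[q q0 hq]] := doeblin s Ss.
pose a n : R := fine (survival S Q s n s).
have aE n : survival S Q s n s = (a n)%:E.
  rewrite fineK // ge0_fin_numE ?survival_ge0 //.
  exact: le_lt_trans (survival_le1 hQ n Ss Ss) (ltry _).
have a0 n : (0 <= a n)%R by rewrite -lee_fin -aE survival_ge0.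
have a_noninc n : (a n.+1 <= a n)%R.
  by rewrite -lee_fin -!aE survival_noninc.
have fE n : first_passage S Q n s s = (a n - a n.+1)%:E.
  have := survival_first_passage hQ n Ss Ss; rewrite !aE.
  by rewrite EFinB => ->; rewrite addeK.
have a_le j : (a (j * n0.+1)%N <= (1 - q) ^+ j)%R.
  by rewrite -lee_fin -aE; exact: (doeblin_survival hQ Ss _ q0 hq).
have q1 : (q <= 1)%R.
  by rewrite -lee_fin (le_trans (hq s Ss)) // kernel_pow_le1.
have a_anti i j : (i <= j)%N -> (a j <= a i)%R.
  move=> ij; rewrite -(subnK ij); elim: (j - i)%N => [//|k IHk].
  by apply: le_trans IHk; rewrite addSn.
have sum_a j : (\sum_(0 <= k < j * n0.+1) a k <= n0.+1%:R * (1 - (1 - q) ^+ j) / q)%R.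
  elim: j => [|j IH]; first by rewrite mul0n big_geq // expr0 subrr mulr0 mul0r.
  rewrite (@big_cat_nat _ _ _ (j * n0.+1)) //=; last by rewrite mulSn leq_addl.
  have block : (\sum_(j * n0.+1 <= k < j.+1 * n0.+1) a k <= n0.+1%:R * (1 - q) ^+ j)%R.
    apply: (@le_trans _ _ (\sum_(j * n0.+1 <= k < j.+1 * n0.+1) (1 - q) ^+ j)%R).
      by apply: ler_sum_nat => k /andP[jk _]; exact: le_trans (a_anti _ _ jk) (a_le j).
    by rewrite sumr_const_nat mulSn addnK mulr_natl.
  apply: le_trans (lerD IH block) _; rewrite le_eqVlt; apply/orP; left; apply/eqP.
  by rewrite exprSr; field; rewrite gt_eqF.
(* Sum of m (1 - q)^j over the blocks j, with m = n0 + 1 *)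
pose C : R := (n0.+1%:R / q)%R.
have series_a n : (series a n <= C)%R.
  have le_n : (n <= n * n0.+1)%N by rewrite leq_pmulr.
  apply: (@le_trans _ _ (series a (n * n0.+1)%N)).
    rewrite /series /= [leRHS](@big_cat_nat _ _ _ n) //= lerDl.
    by apply: sumr_ge0 => k _.
  apply: le_trans (sum_a n) _; rewrite ler_pM2r ?invr_gt0 // ler_piMr //.
  by rewrite gerBl exprn_ge0 // subr_ge0.
have a_cvg0 : a @ \oo --> 0%R.
  apply: cvg_series_cvg_0; apply: nondecreasing_is_cvgn.
    by apply/nondecreasing_seqP => n; rewrite /series /= big_nat_recr //= lerDl.
  by exists C => _ [n _ <-]; exact: series_a.
split.
  have -> : (fun n => \sum_(0 <= k < n) first_passage S Q k s s) =
      (fun n => (1 - a n)%:E).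
    apply/funext => n; rewrite (eq_bigr _ (fun k _ => fE k)) sumEFin; congr EFin.
    elim: n => [|n IH]; last by rewrite big_nat_recr //= IH; ring.
    by rewrite big_geq // (_ : a 0%N = 1%R) ?subrr.
  apply/cvg_lim => //; apply: cvg_EFin; first by near=> n.
  rewrite -[X in _ --> X]subr0; apply: cvgB => //; exact: cvg_cst.
apply: (@le_lt_trans _ _ C%:E); last exact: ltry.
apply: lime_le.
  by apply: is_cvg_nneseries => n _ _; rewrite mule_ge0 ?first_passage_ge0 // lee_fin.
near=> n; rewrite (eq_bigr (fun k => (k.+1%:R * (a k - a k.+1))%:E)); last first.
  by move=> k _; rewrite fE.
rewrite sumEFin lee_fin; apply: le_trans (series_a n).
(* Summation by parts *)
have -> : (series a n = \sum_(0 <= k < n) k.+1%:R * (a k - a k.+1) + n%:R * a n)%R.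
  elim: {+}n => [|k IH]; first by rewrite /series /= !big_geq // mul0r addr0.
  rewrite /series /= !big_nat_recr //= -/(series a k) -[X in (X + _)%R]/(series a k) IH.
  by rewrite -!natr1; ring.
by rewrite lerDl mulr_ge0.
Unshelve. all: by end_near.
Qed.

End Doeblin.

(** * Discrete random variables *)

Section Discrete.
Context {d : measure_display} {T : measurableType d}.

(** Measurability for the discrete sigma-algebra on the codomain, without
    declaring that structure on it *)
Definition discretely_measurable {C : Type} (f : T -> C) : Prop :=
  forall B : set C, measurable (f @^-1` B).

Lemma measurable_exists (I : countType) (A : I -> set T) :
  (forall i, measurable (A i)) -> measurable [set w | exists i, A i w].
Proof.
move=> mA; have -> : [set w | exists i, A i w] =
    \bigcup_n (if unpickle n is Some i then A i else set0).
  apply/seteqP; split=> [w [i Aw]|w [n _]].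
    by exists (pickle i) => //; rewrite pickleK.
  by case: unpickle => // i Aw; exists i.
by apply: bigcupT_measurable => n; case: unpickle.
Qed.

Lemma measurable_forall (I : countType) (A : I -> set T) :
  (forall i, measurable (A i)) -> measurable [set w | forall i, A i w].
Proof.
move=> mA; rewrite -[X in measurable X]setCK; apply: measurableC.
have -> : ~` [set w | forall i, A i w] = [set w | exists i, (~` A i) w].
  by apply/seteqP; split=> w /=; rewrite -existsNE.
by apply: measurable_exists => i; exact: measurableC.
Qed.

Lemma measurable_if (Q : Prop) (A : set T) :
  measurable A -> measurable [set w | Q -> A w].
Proof.
move=> mA; have [q|nq] := pselect Q.
  by rewrite (_ : [set w | _] = A) //; apply/seteqP; split=> w //=; apply.
by rewrite (_ : [set w | _] = setT) //; apply/seteqP; split=> w //= _ /nq.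
Qed.

Lemma discrete_fibers (C : countType) (f : T -> C) :
  (forall c, measurable (f @^-1` [set c])) -> discretely_measurable f.
Proof.
move=> mf B; have -> : f @^-1` B = [set w | exists c, (fun c w => B c /\ f w = c) c w].
  by apply/seteqP; split=> [w Bw|w [c [Bc fw]]] /=; [exists (f w)|rewrite fw].
apply: measurable_exists => c; have [Bc|nBc] := pselect (B c).
  rewrite (_ : (fun w => _) = f @^-1` [set c]) //.
  by apply/seteqP; split=> w /= => [[]|].
by rewrite (_ : (fun w => _) = set0) //; apply/seteqP; split=> w //= [].
Qed.

Lemma discrete_comp (C D : Type) (f : T -> C) (h : C -> D) :
  discretely_measurable f -> discretely_measurable (h \o f).
Proof. by move=> mf B; exact: (mf (h @^-1` B)). Qed.

Lemma discrete_pair (C D : countType) (f : T -> C) (g : T -> D) :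
  discretely_measurable f -> discretely_measurable g ->
  discretely_measurable (fun w => (f w, g w)).
Proof.
move=> mf mg; apply: discrete_fibers => -[a b].
rewrite (_ : _ @^-1` _ = f @^-1` [set a] `&` g @^-1` [set b]).
  by apply: measurableI; [exact: mf|exact: mg].
by apply/seteqP; split=> w /= [-> ->].
Qed.

Lemma discrete_ffun (I : finType) (C : countType) (f : I -> T -> C) :
  (forall i, discretely_measurable (f i)) ->
  discretely_measurable (fun w => [ffun i => f i w]).
Proof.
move=> mf; apply: discrete_fibers => c.
rewrite (_ : _ @^-1` _ = [set w | forall i, (f i @^-1` [set c i]) w]).
  by apply: measurable_forall => i; exact: mf.
by apply/seteqP; split=> w /= => [<- i|h]; [rewrite ffunE|apply/ffunP => i; rewrite ffunE].
Qed.

(** Countable additivity over the fibers of f, indexed by the codes of the points so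
    that the sum is a series *)
Lemma measure_fibers {R : realType} (m : {measure set T -> \bar R})
    (C : countType) (f : T -> C) (X : set T) :
  discretely_measurable f -> measurable X ->
  m X = (\sum_(0 <= k <oo) m (X `&` [set w | pickle (f w) = k]))%E.
Proof.
move=> mf mX; have mk k : measurable [set w | pickle (f w) = k].
  exact: (mf [set c | pickle c = k]).
rewrite -measure_semi_bigcup //.
- congr (m _); apply/seteqP; split=> [w Xw|w [k _ []]] //.
  by exists (pickle (f w)).
- by move=> k; exact: measurableI.
- by move=> i j _ _ [w [[_ <-] [_ <-]]].
- by apply: bigcupT_measurable => k; exact: measurableI.
Qed.

End Discrete.

(** * The law of finitely many rows *)

Section Law.
Context {R : realType} {d : measure_display} {Omega : measurableType d}.
Variables (P : probability Omega R) (L : nat).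
Hypothesis hL : (0 < L)%N.
Variables (mu : nat -> probability nat R).
Variables (xi : 'Z_(2 * L) -> nat -> {RV P >-> nat}).
Variables (tau : 'Z_(2 * L) -> nat -> Omega -> nat).
Hypothesis hglpp : is_glpp mu xi tau.
Implicit Types (x : 'Z_(2 * L)) (y : nat) (T a : 'Z_(2 * L) -> nat -> nat).

Let times (w : Omega) : 'Z_(2 * L) -> nat -> nat := fun x y => tau x y w.

Let tauS x y w : is_cell x y.+1 ->
  tau x y.+1 w = (maxn (tau (x - 1)%R y w) (tau (x + 1)%R y w) + xi x y.+1 w)%N.
Proof. by case: hglpp => _ h _; exact: h. Qed.

Let tau0 x w : is_cell x 0 -> tau x 0%N w = 0%N.
Proof. by case: hglpp => h _ _; exact: h. Qed.

Lemma cell_preds x y : is_cell x y.+1 -> is_cell (x - 1) y /\ is_cell (x + 1) y.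
Proof. by rewrite is_cell_sub1 // is_cell_add1 // is_cellS. Qed.

Lemma xi_discrete x y : discretely_measurable (xi x y : Omega -> nat).
Proof.
by move=> B; rewrite -[_ @^-1` _]setTI; exact: (measurable_funPT (xi x y)).
Qed.

Lemma tau_discrete x y : is_cell x y -> discretely_measurable (tau x y).
Proof.
elim: y x => [|y IH] x c.
  have -> : tau x 0%N = cst 0%N by apply/funext => w; rewrite tau0.
  by move=> B; rewrite preimage_cst; case: ifP.
have [c1 c2] := cell_preds c.
have -> : tau x y.+1 = (fun p : nat * nat * nat => maxn p.1.1 p.1.2 + p.2)%N \o
    (fun w => (tau (x - 1) y w, tau (x + 1) y w, xi x y.+1 w)).
  by apply/funext => w; rewrite tauS.
apply: discrete_comp; apply: discrete_pair; last exact: xi_discrete.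
by apply: discrete_pair; exact: IH.
Qed.

Definition past y a : set Omega :=
  [set w | forall x y', (y' <= y)%N -> is_cell x y' -> tau x y' w = a x y'].

Definition in_row y (K : 'Z_(2 * L) -> set nat) : set Omega :=
  [set w | forall x, is_cell x y.+1 -> K x (xi x y.+1 w)].

Lemma measurable_past y a : measurable (past y a).
Proof.
rewrite (_ : past y a = [set w | forall p : 'Z_(2 * L) * nat,
    (p.2 <= y)%N /\ is_cell p.1 p.2 -> (tau p.1 p.2 @^-1` [set a p.1 p.2]) w]).
  apply: measurable_forall => -[x y'].
  have [c|nc] := boolP (is_cell x y').
    by apply: measurable_if; exact: (tau_discrete c).
  by rewrite (_ : (fun w => _) = setT) //; apply/seteqP; split=> w //= _ [_].
by apply/seteqP; split=> w h; [move=> [x y'] []; exact: h|move=> x y' ? ?; exact: (h (x, y'))].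
Qed.

Lemma measurable_in_row y K : measurable (in_row y K).
Proof.
apply: measurable_forall => x.
exact: (xi_discrete x y.+1 [set k | is_cell x y.+1 -> K x k]).
Qed.

Lemma mu_fin_num Delta (B : set nat) : mu Delta B \is a fin_num.
Proof. by apply: fin_num_measure. Qed.

(** The conditional law of one row, for events that constrain each variable by an
    arbitrary set rather than by a value: the singletons are replaced by sets one
    variable at a time, splitting the new set into its points. *)
Lemma row_law y a K : P (past y a `&` in_row y K) =
  (P (past y a) * \prod_(x : 'Z_(2 * L) | is_cell x y.+1)
     mu `|a (x - 1)%R y - a (x + 1)%R y|%N (K x))%E.
Proof.
pose F (K' : 'Z_(2 * L) -> set nat) x := mu `|a (x - 1)%R y - a (x + 1)%R y|%N (K' x).
(* The cells outside [r] still have a singleton constraint. *)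
have main (r : seq 'Z_(2 * L)) :
    (forall x, is_cell x y.+1 -> x \notin r -> exists k, K x = [set k]) ->
    P (past y a `&` in_row y K) =
    (P (past y a) * \prod_(x : 'Z_(2 * L) | is_cell x y.+1) F K x)%E.
  elim: r K => [|x0 r IH] K hK.
    pose k x := xget 0%N (K x).
    have Kk x : is_cell x y.+1 -> K x = [set k x].
      move=> c; rewrite /k; have [j ->] := hK x c isT.
      by have -> : xget 0%N [set j] = j by exact: (xgetPex 0%N (ex_intro [set j] j erefl)).
    case: hglpp => _ _ /(_ y a k) /=.
    rewrite (_ : [set w | forall x, is_cell x y.+1 -> xi x y.+1 w = k x] = in_row y K).
      by move=> ->; congr (_ * _)%E; apply: eq_bigr => x c; rewrite /F Kk.
    by apply/seteqP; split=> w h x c; have := h x c; rewrite Kk.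
  have [c0|nc0] := boolP (is_cell x0 y.+1); last first.
    apply: IH => x c xr; apply: hK => //; rewrite inE negb_or xr andbT.
    by apply: contraNneq nc0 => <-.
  pose Kj j x := if x == x0 then [set j] else K x.
  have IHj j : P (past y a `&` in_row y (Kj j)) =
      (P (past y a) * \prod_(x : 'Z_(2 * L) | is_cell x y.+1) F (Kj j) x)%E.
    apply: IH => x c xr; rewrite /Kj; case: eqP => [_|/eqP xx0]; first by exists j.
    by apply: hK => //; rewrite inE negb_or xx0.
  pose others := (\prod_(x : 'Z_(2 * L) | is_cell x y.+1 && (x != x0)) F K x)%E.
  rewrite (measure_fibers P (xi_discrete x0 y.+1)); last first.
    by apply: measurableI; [exact: measurable_past|exact: measurable_in_row].
  rewrite (bigD1 x0) //= -/others /F (measure_fibers (mu _) (f := id) (X := K x0)) //.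
  have [c cE] : exists c, (P (past y a) * others)%E = c%:E.
    have : (P (past y a) * others)%E \is a fin_num.
      by apply: fin_numM; [apply: fin_num_measure; exact: measurable_past|
        apply: prode_fin_num => x _; exact: mu_fin_num].
    by case: (_ * _)%E => // c _; exists c.
  rewrite [X in _ = (_ * X)%E]muleC muleA cE -nneseriesZl; last by [].
  apply: eq_eseriesr => j _; have [Kx0j|nKx0j] := pselect (K x0 j).
    have -> : K x0 `&` [set w | pickle w = j] = [set j].
      by apply/seteqP; split=> [k []|k ->].
    rewrite -cE -setIA (_ : in_row y K `&` _ = in_row y (Kj j)).
      have e0 : F (Kj j) x0 = mu `|a (x0 - 1)%R y - a (x0 + 1)%R y|%N [set j].
        by rewrite /F /Kj eqxx.
      rewrite IHj (bigD1 x0) //= e0 -muleA; congr (_ * _)%E.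
      rewrite muleC; congr (_ * _)%E; apply: eq_bigr => x /andP[_ xx0].
      by rewrite /F /Kj (negbTE xx0).
    apply/seteqP; split=> w; rewrite /in_row /Kj /=.
      by move=> [h e] x cx; case: eqP => [->|_]; [|exact: h].
    move=> h; have := h x0 c0; rewrite eqxx => e; split=> // x cx.
    have := h x cx; case: eqP => [->|_] //; by move=> _; rewrite e.
  have -> : K x0 `&` [set w | pickle w = j] = set0.
    by apply/seteqP; split=> [k [+ e]|//]; rewrite -e in nKx0j.
  rewrite measure0 mule0 (_ : _ `&` _ = set0) ?measure0 //.
  by apply/seteqP; split=> [w [[_ /(_ x0 c0) h] e]|//]; apply: nKx0j; rewrite -e.
by apply: (main (enum 'Z_(2 * L))) => x _; rewrite mem_enum.
Qed.

(** The law of total probability for the values of rows 0 to y, which take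
    countably many values *)
Lemma total_past y (X X' : set Omega) (c : R) : 0 <= c ->
  measurable X -> measurable X' ->
  (forall w, P (past y (times w) `&` X) = (c%:E * P (past y (times w) `&` X'))%E) ->
  P X = (c%:E * P X')%E.
Proof.
move=> c0 mX mX' h.
pose profile w := [ffun p : 'Z_(2 * L) * 'I_y.+1 =>
  if is_cell p.1 p.2 then tau p.1 p.2 w else 0%N].
have mprofile : discretely_measurable profile.
  apply: discrete_ffun => -[x i] /=; case: (boolP (is_cell x i)) => [c1|_].
    exact: tau_discrete.
  by move=> B; rewrite preimage_cst; case: ifP.
rewrite !(measure_fibers P mprofile) // -nneseriesZl; last by [].
apply: eq_eseriesr => k _.
have [[w0 w0k]|none] := pselect (exists w0, pickle (profile w0) = k); last first.
  have -> : [set w | pickle (profile w) = k] = set0.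
    by apply/seteqP; split=> [w wk|//]; apply: none; exists w.
  by rewrite !setI0 measure0 mule0.
have -> : [set w | pickle (profile w) = k] = past y (times w0).
  apply/seteqP; split=> [w|w wpast] /=.
    rewrite -w0k => /(pcan_inj pickleK)/ffunP e x y' y'y cx.
    have y'y1 : (y' < y.+1)%N by [].
    by have := e (x, Ordinal y'y1); rewrite !ffunE /= cx.
  rewrite -w0k; congr pickle; apply/ffunP => -[x i]; rewrite !ffunE /=.
  by case: ifP => // cx; apply: wpast => //; rewrite -ltnS.
by rewrite ![_ `&` past _ _]setIC; exact: h.
Qed.

Hypothesis hmu : forall Delta, full_support (mu Delta).

Definition positive_xi : set Omega :=
  [set w | forall x y, is_cell x y.+1 -> (0 < xi x y.+1 w)%N].

Lemma positive_xi_growing w : positive_xi w -> growing (times w).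
Proof.
move=> pos; split=> [x c|x y c]; first exact: tau0.
by have := pos x y c; rewrite /times tauS //; lia.
Qed.

Lemma xi_eq0 x y : is_cell x y.+1 -> P [set w | xi x y.+1 w = 0%N] = 0%E.
Proof.
move=> c; have m0 : measurable [set w | xi x y.+1 w = 0%N].
  exact: (xi_discrete x y.+1 [set 0%N]).
rewrite (@total_past y _ setT 0) ?mul0e // => w; rewrite mul0e.
pose K x' := if x' == x then [set 0%N] else setT.
have -> : [set w | xi x y.+1 w = 0%N] = in_row y K.
  apply/seteqP; split=> w'; rewrite /in_row /K /=.
    by move=> e x' _; case: eqP => [->|].
  by move=> /(_ x c); rewrite eqxx.
rewrite row_law (bigD1 x) //= {1}/K eqxx (proj1 (hmu _)).
by rewrite mul0e mule0.
Qed.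

Lemma measurable_positive_xi : measurable positive_xi.
Proof.
apply: (@measurable_forall _ _ 'Z_(2 * L)) => x; apply: measurable_forall => y.
exact: (xi_discrete x y.+1 [set k | is_cell x y.+1 -> (0 < k)%N]).
Qed.

Lemma positive_xi_as : P (~` positive_xi) = 0%E.
Proof.
pose Z (p : 'Z_(2 * L) * nat) := [set w | is_cell p.1 p.2.+1 /\ xi p.1 p.2.+1 w = 0%N].
have mZ p : measurable (Z p).
  exact: (xi_discrete p.1 p.2.+1 [set k | is_cell p.1 p.2.+1 /\ k = 0%N]).
have Z0 p : P (Z p) = 0%E.
  have [c|nc] := boolP (is_cell p.1 p.2.+1).
    rewrite -(xi_eq0 c); congr (P _).
    by apply/seteqP; split=> w; [case|split].
  by rewrite (_ : Z p = set0) ?measure0 //; apply/seteqP; split=> [w []|//]; rewrite (negbTE nc).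
apply: measure_negligible; first exact/measurableC/measurable_positive_xi.
have : P.-negligible (\bigcup_n (if unpickle n is Some p then Z p else set0)).
  apply: negligible_bigcup => n; case: unpickle => [p|]; last exact: negligible_set0.
  by apply/negligibleP; [exact: mZ|exact: Z0].
apply: negligibleS => w /= nw.
have [x [y [c e]]] : exists x y, is_cell x y.+1 /\ xi x y.+1 w = 0%N.
  apply: contrapT => none; apply: nw => x y c; rewrite lt0n; apply/eqP => e.
  by apply: none; exists x, y.
by exists (pickle (x, y)) => //; rewrite pickleK.
Qed.

(** Events may be compared on the outcomes with positive variables only. *)
Lemma eq_probability (A B : set Omega) : measurable A -> measurable B ->
  (forall w, positive_xi w -> A w <-> B w) -> P A = P B.
Proof.
move=> mA mB AB; have mN := measurableC measurable_positive_xi.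
rewrite -(measureU0 mA mN positive_xi_as) -(measureU0 mB mN positive_xi_as).
congr (P _); apply/seteqP; split=> w /= [].
- by have [/AB h /h ?|] := pselect (positive_xi w); [left|right].
- by right.
- by have [/AB h /h ?|] := pselect (positive_xi w); [left|right].
- by right.
Qed.

(** [K x y] constrains the variable of the cell (x, y + 1). *)
Definition cylinder (K : 'Z_(2 * L) -> nat -> set nat) Y : set Omega :=
  [set w | forall x y, (y < Y)%N -> is_cell x y.+1 -> K x y (xi x y.+1 w)].

Lemma measurable_cylinder K Y : measurable (cylinder K Y).
Proof.
apply: (@measurable_forall _ _ 'Z_(2 * L)) => x; apply: measurable_forall => y.
exact: (xi_discrete x y.+1 [set k | (y < Y)%N -> is_cell x y.+1 -> K x y k]).
Qed.

(** The parameter of a variable is random, but a product formula holds as soon as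
    each variable that is really constrained has its parameter determined by the
    constraints on earlier rows. [T] supplies these parameters. *)
Lemma cylinder_law K T Y :
  (forall x y, is_cell x y.+1 -> K x y = setT \/
     forall w, cylinder K y w ->
       tau (x - 1)%R y w = T (x - 1)%R y /\ tau (x + 1)%R y w = T (x + 1)%R y) ->
  P (cylinder K Y) = (\prod_(y < Y) \prod_(x : 'Z_(2 * L) | is_cell x y.+1)
     mu `|T (x - 1)%R y - T (x + 1)%R y|%N (K x y))%E.
Proof.
move=> hK; elim: Y => [|Y IH].
  rewrite big_ord0 (_ : cylinder K 0 = setT) ?probability_setT //.
  by apply/seteqP; split=> w //= _ x y.
rewrite big_ord_recr /= -IH muleC.
set c := (\prod_(x | _) _)%E.
have c_fin : c \is a fin_num by apply: prode_fin_num => x _; exact: mu_fin_num.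
have c_ge0 : (0 <= c)%E by apply: prode_ge0 => x _; exact: measure_ge0.
rewrite -(fineK c_fin); apply: (@total_past Y); rewrite ?fine_ge0 //; try exact: measurable_cylinder.
move=> w0; rewrite fineK //.
have same w x y : past Y (times w0) w -> (y < Y)%N -> is_cell x y.+1 ->
    xi x y.+1 w = xi x y.+1 w0.
  move=> wp yY cx; have [c1 c2] := cell_preds cx.
  have e1 := wp (x - 1) y (ltnW yY) c1; have e2 := wp (x + 1) y (ltnW yY) c2.
  by have := wp x y.+1 yY cx; rewrite /times !tauS // e1 e2 => /addnI.
have [in0|out0] := pselect (cylinder K Y w0); last first.
  have -> : past Y (times w0) `&` cylinder K Y.+1 = set0.
    apply/seteqP; split=> [w [wp wc]|//]; apply: out0 => x y yY cx.
    by rewrite -(same w) //; apply: wc => //; exact: ltnW.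
  have -> : past Y (times w0) `&` cylinder K Y = set0.
    apply/seteqP; split=> [w [wp wc]|//]; apply: out0 => x y yY cx.
    by rewrite -(same w) //; exact: wc.
  by rewrite measure0 mule0.
have -> : past Y (times w0) `&` cylinder K Y = past Y (times w0).
  apply/setIidl => w wp x y yY cx.
  by rewrite (same w) //; exact: in0.
have -> : past Y (times w0) `&` cylinder K Y.+1 = past Y (times w0) `&` in_row Y (K^~ Y).
  apply/seteqP; split=> w [wp wc]; split=> // x.
    by move=> cx; exact: wc.
  move=> y; rewrite ltnS leq_eqVlt => /orP[/eqP -> cx|yY cx]; first exact: wc.
  by rewrite (same w) //; exact: in0.
rewrite row_law muleC; congr (_ * _)%E; apply: eq_bigr => x cx.
rewrite /times /=; case: (hK x Y cx) => [->|/(_ w0 in0)[-> ->]] //.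
by rewrite !probability_setT.
Qed.

End Law.

(** * The transition kernel *)

Section Kernel.
Context {R : realType}.
Variables (L : nat) (mu : nat -> probability nat R).
Hypothesis hL : (0 < L)%N.
Hypothesis hmu : forall Delta, full_support (mu Delta).
Implicit Types (i x : 'Z_(2 * L)) (U : {set 'Z_(2 * L)}).
Implicit Types s : {ffun 'Z_(2 * L) -> int} * {ffun 'Z_(2 * L) -> nat}.

Definition hazard (Delta m : nat) : R :=
  fine (mu Delta [set m.+1]) / fine (mu Delta [set k | (m < k)%N]).

(** The parameter of the cell above a peak is the difference of the two ages at
    the peak, and the cell has been waiting since the younger of its two
    predecessors was filled. *)
Definition flip_prob s i : R :=
  if peak s i
  then hazard `|s.2 i - s.2 (i + 1)%R|%N (minn (s.2 i) (s.2 (i + 1)%R))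
  else 0.

Definition flip_weight s U : R :=
  \prod_i (if i \in U then flip_prob s i else 1 - flip_prob s i).

(** The law of the next state when the peaks flip independently; sets U that
    contain other columns have weight 0. *)
Definition flip_kernel s s' : R :=
  \sum_(U : {set 'Z_(2 * L)}) flip_weight s U * (flip s U == s')%:R.

Lemma fine_mu_gt0 Delta m (B : set nat) : B m.+1 -> 0 < fine (mu Delta B).
Proof.
move=> Bm; apply: fine_gt0; rewrite ltey_eq mu_fin_num andbT.
apply: lt_le_trans (proj2 (hmu Delta) m.+1 isT) _.
by apply: le_measure; rewrite ?inE // => k ->.
Qed.

Lemma tail_gt0 Delta m : 0 < fine (mu Delta [set k | (m < k)%N]).
Proof. by apply: (@fine_mu_gt0 _ m) => /=. Qed.

Lemma tailE Delta m : fine (mu Delta [set k | (m < k)%N]) =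
  fine (mu Delta [set m.+1]) + fine (mu Delta [set k | (m.+1 < k)%N]).
Proof.
rewrite -fineD ?mu_fin_num // -measureU //.
  congr (fine (mu Delta _)); apply/seteqP; split=> k /=.
    by rewrite leq_eqVlt => /orP[/eqP <-|]; [left|right].
  by case=> [->|/ltnW].
by apply/seteqP; split=> [k [/= ->]|//]; rewrite ltnn.
Qed.

Lemma hazard_gt0 Delta m : 0 < hazard Delta m.
Proof.
by rewrite divr_gt0 ?tail_gt0 // (@fine_mu_gt0 _ m).
Qed.

Lemma hazard_lt1 Delta m : hazard Delta m < 1.
Proof.
by rewrite /hazard ltr_pdivrMr ?tail_gt0 // mul1r tailE ltrDl tail_gt0.
Qed.

Lemma flip_prob_ge0 s i : 0 <= flip_prob s i.
Proof. by rewrite /flip_prob; case: ifP => // _; exact/ltW/hazard_gt0. Qed.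

Lemma flip_prob_lt1 s i : flip_prob s i < 1.
Proof. by rewrite /flip_prob; case: ifP => // _; exact: hazard_lt1. Qed.

Lemma flip_weight_ge0 s U : 0 <= flip_weight s U.
Proof.
apply: prodr_ge0 => i _; case: ifP => _; first exact: flip_prob_ge0.
by rewrite subr_ge0 ltW // flip_prob_lt1.
Qed.

Lemma flip_weight_gt0 s U : U \subset peak s -> 0 < flip_weight s U.
Proof.
move=> /fintype.subsetP Us; apply: prodr_gt0 => i _; case: ifP => [/Us pi|_].
  by rewrite /flip_prob (pi : peak s i) hazard_gt0.
by rewrite subr_gt0 flip_prob_lt1.
Qed.

Lemma flip_weight_eq0 s U : ~~ (U \subset peak s) -> flip_weight s U = 0.
Proof.
case/subsetPn => i Ui npi; rewrite /flip_weight (bigD1 i) //= Ui /flip_prob.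
by rewrite (negbTE (npi : ~~ peak s i)) mul0r.
Qed.

Lemma flip_weight_sum s : \sum_U flip_weight s U = 1.
Proof.
rewrite -bigA_distr big1 // => i _; by rewrite /= addrC subrK.
Qed.

Lemma flip_kernel_ge0 s s' : 0 <= flip_kernel s s'.
Proof.
by apply: sumr_ge0 => U _; rewrite mulr_ge0 ?flip_weight_ge0 // ler0n.
Qed.

Lemma flip_kernel_flip s U : U \subset peak s -> flip_kernel s (flip s U) = flip_weight s U.
Proof.
move=> Us; rewrite /flip_kernel (bigD1 U) //= eqxx mulr1 big1 ?addr0 // => V VU.
have [Vs|nVs] := boolP (V \subset peak s); last by rewrite flip_weight_eq0 // mul0r.
case: eqP => [/(flip_inj Vs Us) e|_]; last by rewrite mulr0.
by rewrite e eqxx in VU.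
Qed.

Lemma flip_kernel_eq0 s s' : (forall U, U \subset peak s -> flip s U <> s') ->
  flip_kernel s s' = 0.
Proof.
move=> h; apply: big1 => U _.
have [Us|nUs] := boolP (U \subset peak s); last by rewrite flip_weight_eq0 // mul0r.
by case: eqP => [/(h U Us)//|_]; rewrite mulr0.
Qed.

(** By realising the state: the flipped state is again a front line. *)
Lemma flip_timed_bridge s U : timed_bridges L s -> U \subset peak s ->
  timed_bridges L (flip s U).
Proof.
move=> /(timed_bridge_snapshot hL)[N /(_ N (leqnn _))[T gT <-]] Us.
have [T' [gT' a <-]] := jumps_extension hL gT Us.
rewrite (agree_snapshot hL gT gT' a) // -snapshotS //.
exact: snapshot_timed_bridge.
Qed.

Lemma flip_kernel_stochastic : stochastic (timed_bridges L) flip_kernel.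
Proof.
split=> [s s' _ _|s Ss]; first exact: flip_kernel_ge0.
under eq_esum do rewrite -sumEFin.
rewrite esum_sum; last first.
  by move=> s' U _ _; rewrite lee_fin mulr_ge0 ?flip_weight_ge0 // ler0n.
transitivity (\sum_U (flip_weight s U)%:E)%E; last by rewrite sumEFin flip_weight_sum.
apply: eq_bigr => U _.
have [Us|nUs] := boolP (U \subset peak s); last first.
  by rewrite flip_weight_eq0 // esum1 // => s' _; rewrite mul0r.
rewrite (esumID [set flip s U]); last first.
  by move=> s' _; rewrite lee_fin mulr_ge0 ?flip_weight_ge0 // ler0n.
have -> : timed_bridges L `&` [set flip s U] = [set flip s U].
  by apply/setIidr => _ ->; exact: flip_timed_bridge.
rewrite esum_set1 ?eqxx ?mulr1 ?lee_fin ?flip_weight_ge0 //.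
rewrite esum1 ?adde0 // => s' [_ ne]; case: eqP => [e|_]; last by rewrite mulr0.
by case: ne.
Qed.

End Kernel.

(** * The Markov property *)

Section Markov.
Context {R : realType} {d : measure_display} {Omega : measurableType d}.
Variables (P : probability Omega R) (L : nat).
Hypothesis hL : (0 < L)%N.
Variables (mu : nat -> probability nat R).
Hypothesis hmu : forall Delta, full_support (mu Delta).
Variables (xi : 'Z_(2 * L) -> nat -> {RV P >-> nat}).
Variables (tau : 'Z_(2 * L) -> nat -> Omega -> nat).
Hypothesis hglpp : is_glpp mu xi tau.
Implicit Types (x i : 'Z_(2 * L)) (y : nat) (T : 'Z_(2 * L) -> nat -> nat).

(** What the front line reveals until time n about the variable of the cell
    (x, y + 1): nothing as long as one of its predecessors is not filled, its
    value once the cell is filled, and a lower bound in between. *)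
Definition visible n T x y : set nat :=
  let start := maxn (T (x - 1)%R y) (T (x + 1)%R y) in
  [set k | (start <= n)%N -> minn (start + k) n.+1 = minn (T x y.+1) n.+1].

Lemma visible_cylinder n T Y w : growing T -> cylinder xi (visible n T) Y w ->
  forall x y, (y <= Y)%N -> is_cell x y ->
    minn (tau x y w) n.+1 = minn (T x y) n.+1.
Proof.
move=> gT vis x y; case: hglpp => tau0 tauS _; elim: y x => [|y IH] x yY c.
  by rewrite tau0 // (row0_growing gT c).
have [c1 c2] := cell_preds hL c; have [l1 l2] := gT.2 x y c.
have := IH _ (ltnW yY) c1; have := IH _ (ltnW yY) c2; have := vis x y yY c.
by rewrite /visible /= tauS //; lia.
Qed.

Lemma agree_visible n T Y w : growing T -> positive_xi xi w -> (n <= Y)%N ->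
  agree n (fun x y => tau x y w) T <-> cylinder xi (visible n T) Y w.
Proof.
move=> gT pos nY; have gw := positive_xi_growing hL hglpp pos.
case: (hglpp) => tau0 tauS _; split=> [a x y yY c|vis x y c].
  have [c1 c2] := cell_preds hL c.
  have := a _ _ c; have := a _ _ c1; have := a _ _ c2.
  by rewrite /visible /= tauS //; lia.
have [yY|Yy] := leqP y Y; first exact: visible_cylinder vis _ _ yY c.
by have := cell_ge hL gT c; have := cell_ge hL gw c; lia.
Qed.

(** A variable that is really constrained has both predecessors filled at time n,
    so that its parameter is known. *)
Lemma visible_law n T Y : growing T -> P (cylinder xi (visible n T) Y) =
  (\prod_(y < Y) \prod_(x : 'Z_(2 * L) | is_cell x y.+1)
     mu `|T (x - 1)%R y - T (x + 1)%R y|%N (visible n T x y))%E.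
Proof.
move=> gT; apply: (cylinder_law hL hglpp) => x y c.
have [start_le|start_gt] := leqP (maxn (T (x - 1)%R y) (T (x + 1)%R y)) n.
  right=> w vis; have [c1 c2] := cell_preds hL c.
  have := visible_cylinder gT vis (leqnn y) c1.
  by have := visible_cylinder gT vis (leqnn y) c2; lia.
by left; apply/seteqP; split=> k; rewrite /visible /=; lia.
Qed.

(** When the later predecessor is filled exactly at time n + 1, the new constraint
    is that the variable is positive, which is almost sure; in all other cases
    without a peak the constraint does not change. *)
Lemma visible_next_other n T x y Delta : growing T -> is_cell x y.+1 ->
  peak (snapshot T n) x && (level T n x == y) = false ->
  mu Delta (visible n.+1 T x y) = mu Delta (visible n T x y).
Proof.
move=> gT c; rewrite (peakP hL) // => npeak; have [l1 l2] := gT.2 x y c.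
have [e|ne] := eqVneq (maxn (T (x - 1)%R y) (T (x + 1)%R y)) n.+1; last first.
  by congr (mu _ _); apply/seteqP; split=> k; rewrite /visible /=; lia.
have -> : visible n T x y = setT.
  by apply/seteqP; split=> k; rewrite /visible /= e ltnn.
have -> : visible n.+1 T x y = ~` [set 0%N].
  by apply/seteqP; split=> k; rewrite /visible /= e leqnn; lia.
by rewrite probability_setC // (proj1 (hmu _)) sube0 probability_setT.
Qed.

(** At a peak, the constraint changes from exceeding m to being m + 1 or to
    exceeding m + 1, where m is the time that the cell has waited. *)
Lemma visible_next_peak n T x : growing T -> peak (snapshot T n) x ->
  let y := level T n x in
  let Delta := `|T (x - 1)%R y - T (x + 1)%R y|%N in
  mu Delta (visible n.+1 T x y) = (mu Delta (visible n T x y) *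
    (if x \in jumps T n then flip_prob mu (snapshot T n) x
     else 1 - flip_prob mu (snapshot T n) x)%:E)%E.
Proof.
move=> gT px y Delta; have [c e l1 l2 l3] := peak_cell hL gT px.
rewrite -/y in c e l1 l2 l3.
have c0 : ~~ is_cell x y by rewrite -is_cellS.
have s1 : (snapshot T n).2 x = (n - T (x - 1)%R y)%N.
  by rewrite snapshot2E // zigzag_pred.
have s2 : (snapshot T n).2 (x + 1) = (n - T (x + 1)%R y)%N.
  by rewrite snapshot2E // e zigzag_same // is_cell_add1.
pose m := (minn (n - T (x - 1)%R y) (n - T (x + 1)%R y))%N.
have -> : flip_prob mu (snapshot T n) x = hazard mu Delta m.
  by rewrite /flip_prob px s1 s2; congr hazard; rewrite /Delta; lia.
have -> : visible n T x y = [set k | (m < k)%N].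
  by apply/seteqP; split=> k; rewrite /visible /= /m; lia.
have tail := tail_gt0 hmu Delta m.
have next : x \in jumps T n = (T x y.+1 == n.+1) by rewrite inE px.
rewrite -[mu Delta [set k | (m < k)%N]]fineK ?mu_fin_num // -EFinM next.
case: eqP => Txy.
  have -> : visible n.+1 T x y = [set m.+1].
    by apply/seteqP; split=> k; rewrite /visible /= /m; lia.
  by rewrite /hazard mulrC divfK ?gt_eqF // fineK ?mu_fin_num.
have -> : visible n.+1 T x y = [set k | (m.+1 < k)%N].
  by apply/seteqP; split=> k; rewrite /visible /= /m; lia.
rewrite mulrBr mulr1 /hazard [_ * (_ / _)]mulrC divfK ?gt_eqF //.
by rewrite (tailE mu) addrC addKr fineK ?mu_fin_num.
Qed.

(** Each column has at most one waiting cell, so the factors that change are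
    indexed by the peaks. *)
Lemma visible_next n T : growing T ->
  P (cylinder xi (visible n.+1 T) n.+1) =
  (P (cylinder xi (visible n T) n.+1) *
   (flip_weight mu (snapshot T n) (jumps T n))%:E)%E.
Proof.
move=> gT; rewrite !visible_law // /flip_weight -prodEFin.
under eq_bigr do rewrite big_mkcond /=.
under [X in _ = (X * _)%E]eq_bigr do rewrite big_mkcond /=.
rewrite exchange_big [X in _ = (X * _)%E]exchange_big -big_split /=.
apply: eq_bigr => x _.
have other (y : 'I_n.+1) : peak (snapshot T n) x && (level T n x == y) = false ->
    (if is_cell x y.+1 then mu `|T (x - 1)%R y - T (x + 1)%R y|%N (visible n.+1 T x y)
     else 1%E) =
    (if is_cell x y.+1 then mu `|T (x - 1)%R y - T (x + 1)%R y|%N (visible n T x y)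
     else 1%E).
  by move=> h; case: ifP => // c; exact: visible_next_other.
have [px|npx] := boolP (peak (snapshot T n) x); last first.
  rewrite inE /flip_prob (negbTE npx) /= subr0 mule1.
  by apply: eq_bigr => y _; apply: other; rewrite (negbTE npx).
have [c _ _ _ _] := peak_cell hL gT px.
have lev_lt : (level T n x < n.+1)%N.
  by rewrite ltnS (leq_trans (zigzag_ge hL x _ gT)) // levelP.
rewrite (bigD1 (Ordinal lev_lt)) //= c visible_next_peak //.
rewrite [X in _ = (X * _)%E](bigD1 (Ordinal lev_lt)) //= c.
rewrite -!muleA; congr (_ * _)%E; rewrite muleC; congr (_ * _)%E.
apply: eq_bigr => y ne; apply: other; rewrite px /=; apply: contraNF ne => /eqP e.
by apply/eqP/val_inj.
Qed.

(** The maximum defining a height need not exist on a null set of outcomes, where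
    the default value 0 is used. *)
Lemma front_height_discrete n i :
  discretely_measurable (fun w => front_height tau n w i).
Proof.
pose B h := [set w | (tau (zigzag i h) h w <= n)%N /\
  forall y, (tau (zigzag i y) y w <= n)%N -> (y <= h)%N].
have tau_m y := tau_discrete hL hglpp (zigzag_cell hL i y).
have mB h : measurable (B h).
  apply: measurableI; first exact: (tau_m h [set k | (k <= n)%N]).
  apply: measurable_forall => y.
  exact: (tau_m y [set k | (k <= n)%N -> (y <= h)%N]).
apply: discrete_fibers => h.
have -> : (fun w => front_height tau n w i) @^-1` [set h] =
    B h `|` [set w | h = 0%N /\ forall j, (~` B j) w].
  have inB w j : B j w -> B (front_height tau n w i) w.
    by move=> Bj; apply: (@xgetPex _ 0%N (B^~ w)); exists j.
  apply/seteqP; split=> w /= => [<-|[Bh|[-> noB]]].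
  - have [[j /inB]|noB] := pselect (exists j, B j w); first by left.
    right; split; last by move=> j Bj; apply: noB; exists j.
    by apply: (@xgetPN _ 0%N (B^~ w)) => j Bj; apply: noB; exists j.
  - have [h1 h2] := inB w h Bh; have [h3 h4] := Bh.
    by apply/eqP; rewrite eqn_leq h2 // h4.
  - exact: (@xgetPN _ 0%N (B^~ w)).
apply: measurableU => //; have [h0|nh0] := pselect (h = 0%N); last first.
  by rewrite (_ : [set w | _] = set0) //; apply/seteqP; split=> w // [].
rewrite (_ : [set w | _] = [set w | forall j, (~` B j) w]).
  by apply: measurable_forall => j; exact: measurableC.
by apply/seteqP; split=> [w []|w noB] //.
Qed.

Lemma timed_front_discrete n : discretely_measurable (timed_front tau n).
Proof.
have -> : timed_front tau n = (fun w =>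
    ([ffun i => (front tau n w) i], [ffun i => (front_age tau n w) i])).
  by apply/funext => w; congr (_, _); apply/ffunP => i; rewrite [RHS]ffunE.
apply: discrete_pair; apply: discrete_ffun => i.
  have -> : (fun w => front tau n w i) =
      (fun h => if zigzag i h == i then -1 else 1) \o (fun w => front_height tau n w i).
    by apply/funext => w; rewrite ffunE.
  by apply: discrete_comp; exact: front_height_discrete.
apply: discrete_fibers => a.
have -> : (fun w => front_age tau n w i) @^-1` [set a] = [set w | exists h,
    (((fun w => front_height tau n w i) @^-1` [set h]) `&`
     (tau (zigzag i h) h @^-1` [set k | (n - k)%N = a])) w].
  apply/seteqP; split=> w /=; rewrite ffunE /=.
    by move=> e; exists (front_height tau n w i).
  by case=> h [-> ].
apply: measurable_exists => h; apply: measurableI; first exact: front_height_discrete.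
exact: (tau_discrete hL hglpp (zigzag_cell hL i h)).
Qed.

Lemma timed_front_bridge n : P (timed_front tau n @^-1` timed_bridges L) = 1%E.
Proof.
rewrite -(@probability_setT _ _ _ P).
apply: (eq_probability hL hglpp hmu) => //; first exact: timed_front_discrete.
move=> w pos; split=> // _.
exact: (snapshot_timed_bridge hL n (positive_xi_growing hL hglpp pos)).
Qed.

Definition history n (s : nat -> {ffun 'Z_(2 * L) -> int} * {ffun 'Z_(2 * L) -> nat}) :
  set Omega := [set w | forall k, (k <= n)%N -> timed_front tau k w = s k].

Lemma measurable_history n s : measurable (history n s).
Proof.
apply: measurable_forall => k.
exact: (timed_front_discrete k [set b | (k <= n)%N -> b = s k]).
Qed.

(** A possible history of timed front lines is, up to a null set, a cylinder event
    on finitely many rows. *)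
Lemma history_law n s T Y : growing T -> (n <= Y)%N ->
  (forall k, (k <= n)%N -> snapshot T k = s k) ->
  P (history n s) = P (cylinder xi (visible n T) Y).
Proof.
move=> gT nY Ts; apply: (eq_probability hL hglpp hmu).
- exact: measurable_history.
- exact: measurable_cylinder.
move=> w pos; have gw := positive_xi_growing hL hglpp pos.
rewrite -(agree_visible gT pos nY); split=> [h|a k kn].
  by apply: (snapshot_agree hL) => // k kn; rewrite Ts // -h.
by rewrite -Ts // -(agree_snapshot hL gw gT a kn).
Qed.

(** Both sides vanish if no outcome with positive variables realises the history,
    or if the next state is not obtained by flipping peaks. Otherwise the passage
    times of such an outcome are extended according to the next state, and both
    events are cylinders for the same passage times. *)
Lemma timed_front_markov :
  markov_with P (timed_bridges L) (flip_kernel mu) (timed_front tau).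
Proof.
split; first exact: flip_kernel_stochastic.
- by move=> n s; exact: timed_front_discrete.
- exact: timed_front_bridge.
move=> n s _; rewrite -/(history n s) -/(history n.+1 s).
have impossible m : (forall w, positive_xi xi w -> ~ history m s w) ->
    P (history m s) = 0%E.
  move=> no; rewrite -(@measure0 _ _ _ P); apply: (eq_probability hL hglpp hmu) => //.
    exact: measurable_history.
  by move=> w pos; split=> // h; exact: no h.
have [[w0 [pos h0]]|none] :=
  pselect (exists w, positive_xi xi w /\ history n s w); last first.
  have no w : positive_xi xi w -> ~ history n s w by move=> ? ?; apply: none; exists w.
  rewrite (impossible n no) mul0e; apply: impossible => w pos h.
  by apply: (no w pos) => k kn; apply: h; exact: leqW.
have g0 := positive_xi_growing hL hglpp pos.
have [[U [Us flipU]]|none] :=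
  pselect (exists U : {set 'Z_(2 * L)}, U \subset peak (s n) /\ flip (s n) U = s n.+1).
  have e0 : snapshot (fun x y => tau x y w0) n = s n by exact: h0.
  rewrite -e0 in Us; have [T [gT a jT]] := jumps_extension hL g0 Us.
  have Ts k : (k <= n)%N -> snapshot T k = s k.
    by move=> kn; rewrite -(agree_snapshot hL g0 gT a kn); exact: h0.
  have TsS k : (k <= n.+1)%N -> snapshot T k = s k.
    rewrite leq_eqVlt => /orP[/eqP ->|]; last exact: Ts.
    by rewrite snapshotS // Ts // jT.
  rewrite (history_law gT (leqnSn n) Ts) (history_law gT (leqnn _) TsS).
  rewrite visible_next // jT Ts // -flipU flip_kernel_flip //.
  by rewrite -e0.
rewrite flip_kernel_eq0 ?mule0 => [|U Us flipU]; last by apply: none; exists U.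
apply: impossible => w posw h; apply: none.
have gw := positive_xi_growing hL hglpp posw.
exists (jumps (fun x y => tau x y w) n).
have e : snapshot (fun x y => tau x y w) n = s n by apply: h; exact: leqnSn.
by rewrite -e jumps_peak -snapshotS //; split=> //; exact: h.
Qed.

End Markov.

(** * Ergodicity *)

Section Ergodicity.
Context {R : realType}.
Variables (L : nat) (mu : nat -> probability nat R).
Hypothesis hL : (0 < L)%N.
Hypothesis hmu : forall Delta, full_support (mu Delta).
Variable alpha : R.
Hypothesis alpha_gt0 : 0 < alpha.
Hypothesis alpha_le : alpha <= inf (hazard_rates mu).
Implicit Types T : 'Z_(2 * L) -> nat -> nat.

Lemma hazard_ge Delta m : alpha <= hazard mu Delta m.
Proof.
apply: (le_trans alpha_le); apply: ge_inf.
  exists 0 => _ [D [t [_ ->]]]; apply: divr_ge0; first exact/fine_ge0/measure_ge0.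
  by apply/fine_ge0/nneseries_ge0 => k _ _; exact: measure_ge0.
exists Delta, m.+1; split=> //; rewrite /hazard; congr (_ / fine _).
rewrite eseries_cond eseries_mkcond (measure_fibers (mu Delta) (f := id : nat -> nat)) //.
apply: eq_eseriesr => k _; case: ifP => /= mk; last first.
  rewrite (_ : _ `&` _ = set0) ?measure0 //.
  by apply/seteqP; split=> j //= -[mj kj]; move: mk; rewrite -kj mj.
by congr (mu _ _); apply/seteqP; split=> [j []|j ->].
Qed.

Let alpha_lt1 : alpha < 1.
Proof. exact: le_lt_trans (hazard_ge 0 0) (hazard_lt1 hmu 0 0). Qed.

Let S := timed_bridges L.
Let Q := @flip_kernel R L mu.
Let hQ : stochastic S Q := flip_kernel_stochastic hL hmu.

(** Flipping all the peaks is the transition with a lower bound uniform in the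
    state: the probability of not flipping a given peak is positive, but it may
    tend to 0 with the ages. *)
Lemma flip_weight_peaks s :
  alpha ^+ (2 * L) <= flip_weight mu s [set i : 'Z_(2 * L) | peak s i]%SET.
Proof.
rewrite -[X in alpha ^+ X](card_cylinder hL) -[X in _ ^+ X]card_ord -prodr_const.
apply: ler_prod => i _; rewrite ltW //= inE /flip_prob.
by case: (peak s i); [exact: hazard_ge|rewrite subr0 ltW].
Qed.

Lemma kernel_pow_path_gt0 T m n : growing T ->
  (0 < kernel_pow S Q n (snapshot T m) (snapshot T (m + n)))%E.
Proof.
move=> gT; have ST k : S (snapshot T k) by exact: snapshot_timed_bridge.
elim: n m => [|n IH] m; first by rewrite addn0 /= eqxx lte_fin.
rewrite addnS -addSn; apply: lt_le_trans _ (kernel_powS_ge Q n (ST m) (ST m.+1) (ST _)).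
apply: mule_gt0; last exact: IH.
rewrite lte_fin snapshotS // /Q flip_kernel_flip ?jumps_peak //.
by rewrite flip_weight_gt0 // jumps_peak.
Qed.

Lemma kernel_pow_eager_ge T m n : growing T ->
  (((alpha ^+ (2 * L)) ^+ n)%:E <=
   kernel_pow S Q n (snapshot (eager m T) m) (snapshot (eager m T) (m + n)))%E.
Proof.
move=> gT; set E := eager m T; have gE : growing E by exact: eager_growing.
have SE k : S (snapshot E k) by exact: snapshot_timed_bridge.
have a0 : 0 <= alpha ^+ (2 * L) by rewrite exprn_ge0 // ltW.
suff main j : (((alpha ^+ (2 * L)) ^+ n)%:E <=
   kernel_pow S Q n (snapshot E (m + j)) (snapshot E (m + j + n)))%E.
  by have := main 0%N; rewrite addn0.
elim: n j => [|n IH] j; first by rewrite expr0 addn0 /= eqxx.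
apply: le_trans _ (kernel_powS_ge Q n (SE _) (SE (m + j).+1) (SE _)).
rewrite exprS EFinM; apply: lee_pmul; rewrite ?lee_fin ?exprn_ge0 ?(ltW alpha_gt0) //.
  rewrite snapshotS // /Q flip_kernel_flip ?jumps_peak // eager_jumps ?leq_addr //.
  exact: flip_weight_peaks.
by have := IH j.+1; rewrite addnS addSn addnS.
Qed.

(** From any state, L or L + 1 steps at which all peaks flip lead to the flat
    state. *)
Lemma kernel_pow_to_flat s : S s -> exists2 k, ((k == L) || (k == L.+1)) &
  (((alpha ^+ (2 * L)) ^+ L.+1)%:E <= kernel_pow S Q k s (flat L))%E.
Proof.
move=> /(timed_bridge_snapshot hL)[N /(_ N (leqnn _))[T gT <-]].
have [k kL kflat] := eager_flat hL N gT; exists k => //.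
rewrite (agree_snapshot hL gT (eager_growing hL N gT) (eager_agree hL N gT) (leqnn _)).
rewrite -kflat; apply: le_trans _ (kernel_pow_eager_ge N k gT).
rewrite lee_fin ler_wiXn2l ?exprn_ge0 ?exprn_ile1 ?ltW //.
by case/orP: kL => /eqP ->.
Qed.

(** Doeblin's condition holds: any state reaches the flat state in L or L + 1 steps
    with a probability bounded below, and any fixed state s is reached from the
    flat state in every large enough number of steps. *)
Lemma flip_kernel_ergodic : ergodic_kernel S Q.
Proof.
apply: doeblin_ergodic => // s Ss.
have [N0 hN0] := timed_bridge_snapshot hL Ss.
have Sflat : S (flat L).
  by have [T gT _] := hN0 N0 (leqnn _); rewrite -(snapshot0 hL gT); exact: snapshot_timed_bridge.
have pos N : (N0 <= N)%N -> exists2 q : R, 0 < q & (q%:E <= kernel_pow S Q N (flat L) s)%E.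
  move=> /hN0[T gT <-]; exists (fine (kernel_pow S Q N (flat L) (snapshot T N))).
    apply: fine_gt0; rewrite -(snapshot0 hL gT) -[X in snapshot T X]add0n.
    rewrite kernel_pow_path_gt0 //= ltey_eq kernel_pow_fin //; exact: snapshot_timed_bridge.
  by rewrite fineK // kernel_pow_fin //; exact: snapshot_timed_bridge.
exists (L.+1 + N0)%N => n n_ge.
have [q1 q1_gt0 hq1] := pos (n - L)%N ltac:(lia).
have [q2 q2_gt0 hq2] := pos (n - L.+1)%N ltac:(lia).
have a0 : 0 < (alpha ^+ (2 * L)) ^+ L.+1 by rewrite !exprn_gt0.
exists ((alpha ^+ (2 * L)) ^+ L.+1 * Num.min q1 q2) => [|u Su].
  by rewrite mulr_gt0 // lt_min q1_gt0.
have [k kL hk] := kernel_pow_to_flat Su.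
have -> : n = (k + (n - k))%N by case/orP: kL => /eqP ->; lia.
apply: le_trans _ (kernel_pow_mul_le hQ k (n - k) Su Sflat Ss).
rewrite EFinM; apply: lee_pmul => //; rewrite ?lee_fin ?(ltW a0) //.
  by rewrite le_min !ltW.
by case/orP: kL => /eqP ->; [apply: le_trans _ hq1|apply: le_trans _ hq2];
  rewrite lee_fin ge_min lexx ?orbT.
Qed.

End Ergodicity.

Unset Implicit Arguments.
Set Strict Implicit.
Set Printing Implicit Defensive.

Theorem theorem10 (R : realType) (d : measure_display)
    (Omega : measurableType d) (P : probability Omega R)
    (L : nat) (hL : (0 < L)%N)
    (mu : nat -> probability nat R) (hmu : forall Delta, full_support (mu Delta))
    (xi : 'Z_(2 * L) -> nat -> {RV P >-> nat})
    (tau : 'Z_(2 * L) -> nat -> Omega -> nat)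
    (hglpp : is_glpp mu xi tau) :
  [/\ markov_chain P (timed_bridges L) (timed_front tau),
      hidden_markov_chain P (timed_bridges L) fst (front tau)
    & (exists2 alpha : R, 0 < alpha & alpha <= inf (hazard_rates mu)) ->
      ergodic_markov_chain P (timed_bridges L) (timed_front tau) /\
      ergodic_hidden_markov_chain P (timed_bridges L) fst (front tau)].
Proof.
have markov := timed_front_markov hL hmu hglpp.
have chain : markov_chain P (timed_bridges L) (timed_front tau).
  by exists (flip_kernel mu).
split=> //; first by exists (timed_front tau).
move=> [alpha alpha_gt0 alpha_le].
have ergodic : ergodic_markov_chain P (timed_bridges L) (timed_front tau).
  by exists (flip_kernel mu); split=> //; exact: flip_kernel_ergodic alpha_le.
by split=> //; exists (timed_front tau).
Qed.
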